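(* Let $X,Y,Z\subseteq\mathbb{R}^n$ be compact sets which are the supports of Borel probability measures $\mu,\nu,\gamma$ respectively, with $X\cap Y=\emptyset$, and assume $\mu$ and $\gamma$ are absolutely continuous with respect to Lebesgue measure on $\mathbb{R}^n$. Then the problem $$\inf_{\lambda\in\Pi(\mu,\nu,\gamma)}\int\big(|x-y|+|x-z|^2+|y-z|^2\big)\,d\lambda(x,y,z)$$ admits a unique optimal plan, and it is of the form $\lambda=(\mathrm{id}\times T)\#\mu$ for a (unique) measurable map $T:X\to Y\times Z$.
   Context: $|\cdot|$ is the Euclidean norm on $\mathbb{R}^n$. $\Pi(\mu,\nu,\gamma)$ is the set of Borel probability measures on $X\times Y\times Z$ with marginals $\mu,\nu,\gamma$. $(\mathrm{id}\times T)\#\mu$ is the push-forward of $\mu$ under $x\mapsto(x,T(x))$. *)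

(* Defs.v *)
From HB Require Import structures.
From mathcomp Require Import all_boot all_order all_algebra.
From mathcomp Require Import all_classical all_reals all_analysis.
Set Implicit Arguments. Unset Strict Implicit. Unset Printing Implicit Defensive.
Import Order.TTheory GRing.Theory Num.Theory.
Import numFieldNormedType.Exports.
Local Open Scope classical_set_scope.
Local Open Scope ring_scope.

(* R^n is represented by row vectors 'rV[R]_n (its topology is the usual one). *)
Definition Rn (R : realType) (n : nat) : Type :=
  g_sigma_algebraType (@open 'rV[R]_n).

Definition enorm (R : realType) (n : nat) (x : 'rV[R]_n) : R :=
  Num.sqrt (\sum_(i < n) (x ord0 i) ^+ 2).

Definition box (R : realType) (n : nat) (a b : 'rV[R]_n) : set 'rV[R]_n :=
  [set x | forall i, a ord0 i <= x ord0 i <= b ord0 i].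
Definition box_vol (R : realType) (n : nat) (a b : 'rV[R]_n) : R :=
  \prod_(i < n) (b ord0 i - a ord0 i).

Definition lebesgue_null (R : realType) (n : nat) (A : set 'rV[R]_n) : Prop :=
  forall eps : R, 0 < eps ->
    exists a b : nat -> 'rV[R]_n,
      (forall k i, a k ord0 i <= b k ord0 i) /\
      A `<=` \bigcup_k box (a k) (b k) /\
      (forall N, \sum_(k < N) box_vol (a k) (b k) <= eps).

Definition leb_abs_cont (R : realType) (n : nat)
    (mu : set (Rn R n) -> \bar R) : Prop :=
  forall A : set (Rn R n), measurable A -> lebesgue_null A -> mu A = 0%E.

Definition msupport (R : realType) (n : nat)
    (mu : set (Rn R n) -> \bar R) : set 'rV[R]_n :=
  [set x | forall U : set 'rV[R]_n, open U -> U x -> (0 < mu U)%E].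

Definition T3 (R : realType) (n : nat) := ((Rn R n * Rn R n) * Rn R n)%type.

Definition coupling3 (R : realType) (n : nat)
    (mu nu ga : probability (Rn R n) R) (lam : probability (T3 R n) R) : Prop :=
  (forall A : set (Rn R n), measurable A ->
     lam ((fun p : T3 R n => p.1.1) @^-1` A) = mu A) /\
  (forall A : set (Rn R n), measurable A ->
     lam ((fun p : T3 R n => p.1.2) @^-1` A) = nu A) /\
  (forall A : set (Rn R n), measurable A ->
     lam ((fun p : T3 R n => p.2) @^-1` A) = ga A).

Definition cost3 (R : realType) (n : nat) (p : T3 R n) : R :=
  let x : 'rV[R]_n := p.1.1 in let y : 'rV[R]_n := p.1.2 in
  let z : 'rV[R]_n := p.2 in
  enorm (x - y) + enorm (x - z) ^+ 2 + enorm (y - z) ^+ 2.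

Definition total_cost (R : realType) (n : nat) (lam : probability (T3 R n) R)
  : \bar R := (\int[lam]_p (cost3 p)%:E)%E.

Definition optimal_plan (R : realType) (n : nat)
    (mu nu ga : probability (Rn R n) R) (lam : probability (T3 R n) R) : Prop :=
  coupling3 mu nu ga lam /\
  forall lam' : probability (T3 R n) R,
    coupling3 mu nu ga lam' -> (total_cost lam <= total_cost lam')%E.

(* lam = (id x T) # mu, for T : X -> Y x Z (mu is concentrated on X) *)
Definition induced_by_map (R : realType) (n : nat)
    (mu : probability (Rn R n) R) (X : set (Rn R n))
    (T : Rn R n -> Rn R n * Rn R n) (lam : probability (T3 R n) R) : Prop :=
  forall A : set (T3 R n), measurable A ->
    lam A = mu (X `&` (fun x => ((x, (T x).1), (T x).2) : T3 R n) @^-1` A).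

(* Main.v *)
Require Import Defs.
From HB Require Import structures.
From mathcomp Require Import all_boot all_order all_algebra.
From mathcomp Require Import all_classical all_reals all_analysis.
From mathcomp Require Import measurable_realfun ring lra.
Set Implicit Arguments. Unset Strict Implicit. Unset Printing Implicit Defensive.
Import Order.TTheory GRing.Theory Num.Theory.
Import numFieldNormedType.Exports.
Local Open Scope classical_set_scope.
Local Open Scope ring_scope.

(* Neither duality nor a.e. differentiability of potentials is used: only
   exchanges between two points of the support.

   Existence: along an ultrafilter, a minimizing sequence of couplings converges
   to a finitely additive set function w.  Since the marginals are fixed and
   Borel regular, w is approximated from inside by closed and from outside by
   open sets on an algebra containing all cylinders, hence it is sigma-additive
   there by compactness and extends to a coupling; as P(U) <= w(U) for open U,
   the layer-cake formula shows that its cost is minimal.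

   Structure: pushing lam x lam forward by the exchange of one coordinate
   wherever this lowers the cost, and averaging the two resulting laws, gives a
   competitor of lam.  So no exchange of x, y or z between two points of the
   support of an optimal lam lowers the cost.  Exchanging x, resp. z, shows that
   the points x, resp. z, lying under two support points with different partial
   gradients of the cost are covered by countably many Lipschitz graphs, which
   are null for mu, resp. ga.  Outside these sets, the gradients in x and the
   exchange of y force z and the direction of x - y to depend only on x, and
   then the gradient 4 z - 2 (x + y) in z determines y.

   Uniqueness: the average of two optimal plans is optimal, and its graph
   carries both of them. *)

(** * Continuity *)

(* Pointwise forms of the continuity lemmas over an abstract domain: on a
   matrix domain the filter [nbhs x] gets unfolded by unification and the
   library versions no longer apply. *)
Section pointwise_continuity.
Variables (R : realType) (T : topologicalType).
Implicit Types f g : T -> R.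

Lemma cont_at_add f g x : {for x, continuous f} -> {for x, continuous g} ->
  {for x, continuous (fun t => f t + g t)}.
Proof. by move=> cf cg; exact: cvgD. Qed.

Lemma cont_at_opp f x : {for x, continuous f} -> {for x, continuous (fun t => - f t)}.
Proof. by move=> cf; exact: cvgN. Qed.

Lemma cont_at_mul f g x : {for x, continuous f} -> {for x, continuous g} ->
  {for x, continuous (fun t => f t * g t)}.
Proof. by move=> cf cg; exact: cvgM. Qed.

Lemma cont_at_norm f x : {for x, continuous f} ->
  {for x, continuous (fun t => `|f t|)}.
Proof. by move=> cf; exact: cvg_norm. Qed.

Lemma cont_at_inv f x : f x != 0 -> {for x, continuous f} ->
  {for x, continuous (fun t => (f t)^-1)}.
Proof. by move=> fx cf; exact: cvgV. Qed.

Lemma cont_at_sqrt f x : {for x, continuous f} ->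
  {for x, continuous (fun t => Num.sqrt (f t))}.
Proof. by move=> cf; apply: continuous_comp => //; exact: sqrt_continuous. Qed.

Lemma cont_at_sum n (f : 'I_n -> T -> R) x :
  (forall i, {for x, continuous (f i)}) ->
  {for x, continuous (fun t => \sum_i f i t)}.
Proof.
move=> cf; apply: cvg_big => [|i _]; [exact: add_continuous|exact: cf].
Qed.

Lemma cont_at_cst (U : topologicalType) (a : U) (x : T) :
  {for x, continuous (fun _ : T => a)}.
Proof. exact: cvg_cst. Qed.

Lemma cont_at_coord n (u : T -> 'rV[R]_n) j x : {for x, continuous u} ->
  {for x, continuous (fun t => u t ord0 j)}.
Proof.
move=> cu A HA; apply: (cu (fun M : 'rV[R]_n => A (M ord0 j))).
exact: (@coord_continuous R 1 n ord0 j (u x)).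
Qed.

Lemma cont_at_row n (u : T -> 'rV[R]_n) x :
  (forall j, {for x, continuous (fun t => u t ord0 j)}) ->
  {for x, continuous u}.
Proof.
move=> cu A [Q HQ QA].
have H : nbhs x (fun t => forall j, Q ord0 j (u t ord0 j)).
  by apply: filter_forall => j; apply: cu; exact: (HQ ord0 j).
by apply: filterS H => t Ht; apply: QA => i j; rewrite (ord1 i).
Qed.

End pointwise_continuity.

(** * Finitely additive limits of probability measures *)

(* Limits along one ultrafilter, in the form: every linear inequality that holds
   eventually passes to the limit. *)
Lemma exists_ultralimit (R : realType) (I : Type) (a : nat -> I -> R) :
  (forall k i, 0 <= a k i <= 1) ->
  exists w : I -> R, forall (m : nat) (c : 'I_m -> R) (e : 'I_m -> I) (b : R),
    (\forall k \near \oo, \sum_(j < m) c j * a k (e j) <= b) ->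
    \sum_(j < m) c j * w (e j) <= b.
Proof.
move=> a01.
have [U [UU ooU]] := @ultraFilterLemma nat \oo _.
have UP : ProperFilter U by exact: ultra_proper.
have cva i : exists l : R, a k i @[k --> U] --> l.
  have F01 : (a k i @[k --> U]) `[0, 1]%classic.
    by apply: (@filterE _ U) => k /=; rewrite in_itv /=; apply: a01.
  have := @segment_compact R 0 1.
  rewrite /compact => /(_ (a k i @[k --> U]) _ F01) [l [_ cl]].
  exists l; apply/cvgrPdist_lt => e e0.
  (* The cluster point [l] is a limit: an ultrafilter missing the indices with [a k i] within [e] of
     [l] contains their complement, on which the values avoid a ball around [l]. *)
  have [//|UcA] := in_ultra_setVsetC [set k | `|l - a k i| < e] UU.
  have UcA' : (a k i @[k --> U]) (~` ball l e) by exact: UcA.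
  by have [y []] := cl _ _ UcA' (nbhsx_ballx _ _ e0).
exists (fun i => projT1 (cid (cva i))) => m c e b H.
have FU := UP : Filter U.
apply: (@cvgr_to_le _ U _ _ (fun k => \sum_(j < m) c j * a k (e j))).
- apply: cvg_big => [|j _]; first exact: add_continuous.
  by apply: cvgMr; exact: projT2 (cid (cva (e j))).
- exact: ooU.
Qed.

(* The "topology" lc_open is an abstract family of measurable sets, so that it
   need not be a canonical structure on the measurable type T. *)
Record limit_content d (T : measurableType d) (R : realType) := LimitContent {
  lc_open : set (set T) ;
  lc_val : set T -> R ;
  lc_K : set T ;
  lc_openM : forall O, lc_open O -> measurable O ;
  lc_openT : lc_open setT ;
  lc_open0 : lc_open set0 ;
  lc_openU : forall O1 O2, lc_open O1 -> lc_open O2 -> lc_open (O1 `|` O2) ;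
  lc_openI : forall O1 O2, lc_open O1 -> lc_open O2 -> lc_open (O1 `&` O2) ;
  lc_ge0 : forall A, 0 <= lc_val A ;
  lc_valT : lc_val setT = 1 ;
  lc_valU : forall A B, measurable A -> measurable B -> A `&` B = set0 ->
    lc_val (A `|` B) = lc_val A + lc_val B ;
  lc_mK : measurable lc_K ;
  lc_valK : lc_val lc_K = 1 ;
  lc_compact : forall O : nat -> set T, (forall i, lc_open (O i)) ->
    lc_K `<=` \bigcup_i O i -> exists N, lc_K `<=` \big[setU/set0]_(i < N) O i
}.

Section limit_content_theory.
Context d (T : measurableType d) (R : realType) (L : limit_content T R).
Local Notation w := (lc_val L).
Local Notation op := (lc_open L).

(** Here [F] is closed in the sense that its complement belongs to [lc_open]. These sets form an
    algebra, as shown below, on which compactness of [lc_K] forces sigma-additivity. *)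
Definition lc_approx : set (set T) := [set A | measurable A /\
  forall e : R, 0 < e -> exists F O, [/\ op (~` F), op O, F `<=` A, A `<=` O &
    w (O `\` F) <= e]].

Lemma lc_val0 : w set0 = 0.
Proof.
have := @lc_valU _ _ _ L set0 set0 measurable0 measurable0 (setI0 _).
by rewrite setU0; lra.
Qed.

Lemma lc_le A B : measurable A -> measurable B -> A `<=` B -> w A <= w B.
Proof.
move=> mA mB AB; have := @lc_valU _ _ _ L A (B `\` A) mA (measurableD mB mA).
rewrite setDIK => /(_ erefl); rewrite setDUK// => ->.
by rewrite lerDl lc_ge0.
Qed.

Lemma lc_leU A B : measurable A -> measurable B -> w (A `|` B) <= w A + w B.
Proof.
move=> mA mB; have := @lc_valU _ _ _ L A (B `\` A) mA (measurableD mB mA).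
rewrite setDIK => /(_ erefl); rewrite setDE setUIr setUCr setIT -setDE => ->.
by rewrite lerD2l lc_le//; exact: measurableD.
Qed.

Lemma lc_le_bigU (A : nat -> set T) n : (forall i, measurable (A i)) ->
  w (\big[setU/set0]_(i < n) A i) <= \sum_(i < n) w (A i).
Proof.
move=> mA; elim: n => [|n ih]; first by rewrite !big_ord0 lc_val0.
rewrite !big_ord_recr/=; apply: le_trans (lc_leU _ _) _ => //.
  exact: bigsetU_measurable.
by rewrite lerD2r.
Qed.

Lemma lc_approx0 : lc_approx set0.
Proof.
split=> // e e0; exists set0, set0; split => //.
- by rewrite setC0; exact: lc_openT.
- exact: lc_open0.
- by rewrite setD0 lc_val0 ltW.
Qed.

Lemma lc_approxC : setC_closed lc_approx.
Proof.
move=> A [mA H]; split; first exact: measurableC.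
move=> e /H [F [ O [oF oO FA AO wOF]]]; exists (~` O), (~` F); split => //.
- by rewrite setCK.
- exact: subsetC.
- exact: subsetC.
- by rewrite setDE setCK setIC -setDE.
Qed.

Lemma lc_approxU : setU_closed lc_approx.
Proof.
move=> A B [mA HA] [mB HB]; split; first exact: measurableU.
move=> e e0; have e20 : 0 < e / 2 by rewrite divr_gt0.
have [F1 [ O1 [oF1 oO1 FA1 AO1 w1]]] := HA _ e20.
have [F2 [ O2 [oF2 oO2 FA2 AO2 w2]]] := HB _ e20.
exists (F1 `|` F2), (O1 `|` O2); split.
- by rewrite setCU; exact: lc_openI.
- exact: lc_openU.
- exact: setUSS.
- exact: setUSS.
have mF1 : measurable F1 by rewrite -(setCK F1); exact: measurableC (lc_openM oF1).
have mF2 : measurable F2 by rewrite -(setCK F2); exact: measurableC (lc_openM oF2).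
have mO1 := lc_openM oO1. have mO2 := lc_openM oO2.
have mD1 : measurable (O1 `\` F1) by exact: measurableD.
have mD2 : measurable (O2 `\` F2) by exact: measurableD.
apply: (@le_trans _ _ (w ((O1 `\` F1) `|` (O2 `\` F2)))).
  apply: lc_le; [|exact: measurableU|].
    by apply: measurableD; exact: measurableU.
  by move=> x [[Ox|Ox] /not_orP[nF1 nF2]]; [left|right].
apply: le_trans (lc_leU mD1 mD2) _; lra.
Qed.

(** Compactness: on [lc_K], which has full content, a closed set [C] inside [A] is covered by
    finitely many open sets slightly larger than the [F n]. Half of [e] pays for [A] minus [C], the
    other half for the enlargements, geometrically in [n]. *)
Lemma lc_sigma_subadditive (A : set T) (F : nat -> set T) (e : R) :
  (forall n, lc_approx (F n)) -> lc_approx A -> A `<=` \bigcup_n F n ->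
  0 < e -> exists N, w A <= \sum_(i < N) w (F i) + e.
Proof.
move=> mF mA AF e0.
have e20 : 0 < e / 2 by rewrite divr_gt0.
have [mA' /(_ _ e20) [C [ O [oC oO CA AO wOC]]]] := mA.
have /choice [G HG] : forall i, exists G, [/\ lc_open L G, F i `<=` G &
    lc_val L G <= lc_val L (F i) + e / 2 / 2 ^+ i.+1].
  move=> i; have [mFi /(_ (e / 2 / 2 ^+ i.+1))] := mF i.
  case; first by rewrite divr_gt0// exprn_gt0.
  move=> C' [ O' [oC' oO' CA' AO' wOC']]; exists O'; split=> //.
  have mC' : measurable C'.
    by rewrite -(setCK C'); exact: measurableC (lc_openM oC').
  have mD : measurable (O' `\` C') by exact: measurableD (lc_openM oO') mC'.
  apply: (@le_trans _ _ (lc_val L (F i `|` (O' `\` C')))).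
    apply: lc_le; [exact: lc_openM oO'|exact: measurableU|].
    move=> x Ox; have [Fx|nFx] := pselect (C' x); [left; exact: CA'|by right].
  by apply: (le_trans (lc_leU mFi mD)); rewrite lerD2l.
have mG i : measurable (G i : set T) by have [/lc_openM] := HG i.
have mC : measurable (C : set T).
  by rewrite -(setCK C); exact: measurableC (lc_openM oC).
have [N KN] : exists N, lc_K L `<=` ~` C `|` \big[setU/set0]_(i < N) G i.
  (* The complement of [C] sits at index 0 of the cover, ahead of the sets [G i], so that the whole
     of [lc_K] is covered. *)
  have [|x Kx|N KN] := @lc_compact _ _ _ L
    (fun i => if i is i'.+1 then G i' else ~` C).
  - by move=> [//|i]; have [] := HG i.
  - have [Cx|nCx] := pselect (C x); last by exists 0%N.
    have [i _ Fx] := AF _ (CA _ Cx); exists i.+1 => //=.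
    by have [_ + _] := HG i; apply.
  - exists N => x /KN; case: N {KN} => [|N]; first by rewrite big_ord0.
    rewrite big_ord_recl/= => -[|]; first by left.
    by move=> H; right; rewrite big_ord_recr; left.
have mGN : measurable (\big[setU/set0]_(i < N) (G i : set T)).
  exact: bigsetU_measurable.
have mK := lc_mK L.
have wK0 : lc_val L (~` lc_K L) = 0.
  have := @lc_valU _ _ _ L _ _ mK (measurableC mK) (setICr _).
  rewrite setUCr lc_valT lc_valK; lra.
have wAC : lc_val L (A `\` C) <= e / 2.
  apply: le_trans wOC; apply: lc_le; [exact: measurableD|exact: measurableD
    (lc_openM oO) mC|exact: setSD].
have eps M : \sum_(i < M) (e / 2 / 2 ^+ i.+1) = e / 2 - e / 2 / 2 ^+ M :> R.
  elim: M => [|M ih]; first by rewrite big_ord0 expr0; lra.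
  rewrite big_ord_recr/= ih exprS invfM; lra.
exists N.
  apply: (@le_trans _ _ (lc_val L ((A `\` C) `|` ((~` lc_K L) `|`
      \big[setU/set0]_(i < N) G i)))).
    apply: lc_le => //.
      apply: measurableU; first exact: measurableD.
      by apply: measurableU => //; exact: measurableC.
    move=> x Ax; have [Cx|nCx] := pselect (C x); last by left.
    have [Kx|nKx] := pselect (lc_K L x); last by right; left.
    by right; right; have [] := KN _ Kx.
  apply: le_trans (lc_leU _ _) _ => //.
  - exact: measurableD.
  - by apply: measurableU => //; exact: measurableC.
  apply: (@le_trans _ _ (e / 2 + (0 + \sum_(i < N) lc_val L (G i)))).
    apply: lerD => //; apply: le_trans (lc_leU _ _) _ => //.
      exact: measurableC.
    by rewrite wK0 lerD2l; exact: lc_le_bigU.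
  rewrite add0r addrC.
  apply: (@le_trans _ _ (\sum_(i < N) (lc_val L (F i) + e / 2 / 2 ^+ i.+1)
      + e / 2)).
    by rewrite lerD2r; apply: ler_sum => i _; have [] := HG i.
  rewrite big_split/= eps.
  have : 0 <= e / 2 / 2 ^+ N by rewrite divr_ge0 ?exprn_ge0 ?ltW.
  lra.
Qed.

End limit_content_theory.

(** * Extension of the limit content to a probability measure *)

(** A copy of [T] tagged with [L], so that it can carry the algebra [lc_approx L] in place of the
    measurable sets of [T]; [lc_display] tags the display likewise. *)
Definition lc_type d (T : measurableType d) (R : realType)
  (L : limit_content T R) : Type := T.
Definition lc_display d (T : measurableType d) (R : realType)
  (L : limit_content T R) : measure_display. Proof. exact. Qed.

Section limit_content_measure.
Context d (T : measurableType d) (R : realType) (L : limit_content T R).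

HB.instance Definition _ := Pointed.on (lc_type L).
HB.instance Definition _ := @isAlgebraOfSets.Build (lc_display L) (lc_type L)
  (lc_approx L) (lc_approx0 L) (@lc_approxU _ _ _ L) (@lc_approxC _ _ _ L).

Definition lc_content (A : set (lc_type L)) : \bar R := (lc_val L A)%:E.

Let ge0 A : (0 <= lc_content A)%E.
Proof. by rewrite lee_fin lc_ge0. Qed.

Let add : measure_function.semi_additive lc_content.
Proof.
apply/additive2P; first by rewrite /lc_content lc_val0.
move=> A B [mA _] [mB _] AB; rewrite /lc_content lc_valU//.
Qed.

HB.instance Definition _ := isContent.Build _ _ _ lc_content ge0 add.

Let ssub : measurable_subset_sigma_subadditive lc_content.
Proof.
move=> A F mF mA AF; apply/lee_addgt0Pr => e e0.
have [N wA] := lc_sigma_subadditive mF mA AF e0.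
apply: (@le_trans _ _ ((\sum_(i < N) lc_val L (F i))%:E + e%:E)%E).
  by rewrite -EFinD lee_fin.
rewrite leeD2r// -sumEFin.
apply: le_trans (nneseries_lim_ge N (fun i _ _ => ge0 (F i))).
by rewrite big_mkord.
Qed.

HB.instance Definition _ :=
  Content_SigmaSubAdditive_isMeasure.Build _ _ _ lc_content ssub.

End limit_content_measure.

Lemma exists_probability d (T : measurableType d) (R : realType)
    (P : set T -> \bar R) :
  P set0 = 0%E -> (forall A, (0 <= P A)%E) -> semi_sigma_additive P ->
  P setT = 1%E -> exists Q : probability T R, forall A, Q A = P A.
Proof.
move=> P0 Pge0 Padd PT.
pose M := isMeasure.Build _ _ _ P P0 Pge0 Padd.
pose m : {measure set T -> \bar R} := HB.pack P M.
pose N := Measure_isProbability.Build _ _ _ m PT.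
pose Q : probability T R := HB.pack (Measure.sort m) N.
by exists Q.
Qed.

(** With [f] the identity, this also turns a measure of mass one into a bundled probability, or
    passes to a smaller sigma-algebra. *)
Lemma exists_pushforward d d' (T : measurableType d) (T' : measurableType d')
    (R : realType) (m : {measure set T -> \bar R}) (f : T -> T') :
  m setT = 1%E -> measurable_fun setT f ->
  exists Q : probability T' R, forall A, Q A = m (f @^-1` A).
Proof.
move=> mT mf; apply: exists_probability.
- by rewrite preimage_set0 measure0.
- by move=> A; exact: measure_ge0.
- move=> F mF tF mUF; rewrite preimage_bigcup.
  apply: measure_semi_sigma_additive.
  + by move=> n; rewrite -[X in measurable X]setTI; exact: mf.
  + apply/trivIsetP => /= i j _ _ ij; rewrite -preimage_setI.
    by move/trivIsetP : tF => /(_ _ _ _ _ ij) ->//; rewrite preimage_set0.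
  + by rewrite -preimage_bigcup -[X in measurable X]setTI; exact: mf.
- by rewrite preimage_setT.
Qed.

(** The Caratheodory extension of [lc_content] lives on the sigma-algebra generated by
    [lc_approx L]. By hypothesis this contains the measurable sets of [T], so the extension is
    brought back to [T] along the identity. *)
Lemma limit_content_extension d (T : measurableType d) (R : realType)
    (L : limit_content T R) :
  @measurable _ T `<=` <<s lc_approx L >> ->
  exists P : probability T R, forall A, lc_approx L A -> P A = (lc_val L A)%:E.
Proof.
move=> sub.
pose S := g_sigma_algebraType (@measurable _ (lc_type L)).
pose m : {measure set S -> \bar R} := measure_extension (@lc_content _ _ _ L).
have mid : measurable_fun setT (id : S -> T).
  by move=> _ A mA; rewrite setTI; exact: sub.
have mE A : lc_approx L A -> m A = (lc_val L A)%:E.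
  by move=> LA; rewrite /m /= /measure_extension measurable_mu_extE.
have mT : m setT = 1%E.
  rewrite mE ?lc_valT//; exact: (@measurableT _ (lc_type L)).
have [Q QE] := exists_pushforward mT mid.
by exists Q => A LA; rewrite QE -mE.
Qed.

(** * Borel sets of R^n and of its products *)

Definition nat_base (T : topologicalType) (B : nat -> set T) :=
  (forall i, open (B i)) /\
  forall x U, open U -> U x -> exists i, B i x /\ B i `<=` U.

Lemma count_nat_base (T : topologicalType) (I : countType) (B : I -> set T) :
  (forall i, open (B i)) ->
  (forall x U, open U -> U x -> exists i, B i x /\ B i `<=` U) ->
  exists B' : nat -> set T, nat_base B'.
Proof.
move=> oB bB; exists (fun k => if unpickle k is Some i then B i else set0).
split=> [k|x U oU Ux]; first by case: unpickle => [i|]; [exact: oB|exact: open0].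
by have [i Hi] := bB x U oU Ux; exists (pickle i); rewrite pickleK.
Qed.

Lemma open_setX (T U : topologicalType) (A : set T) (B : set U) :
  open A -> open B -> open (A `*` B).
Proof.
move=> oA oB; rewrite (_ : A `*` B = (fst @^-1` A) `&` (snd @^-1` B))//.
by apply: openI; apply: open_comp => // -[x y] _; [exact: cvg_fst|exact: cvg_snd].
Qed.

(** The index map [p] is exposed so that the base sets stay visible as rectangles. *)
Lemma prod_nat_base (T U : topologicalType) (B : nat -> set T) (C : nat -> set U) :
  nat_base B -> nat_base C -> exists p : nat -> nat * nat,
  nat_base (fun k => B (p k).1 `*` C (p k).2).
Proof.
move=> [oB bB] [oC bC].
exists (fun k => odflt (0%N, 0%N) (unpickle k)); split.
  by move=> k; exact: open_setX.
move=> [x y] W oW Wxy.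
have [[P Q] [/= Px Qy] PQ] : nbhs (x, y) W by exact: open_nbhs_nbhs.
move: Px Qy; rewrite !nbhsE => -[P' [oP' P'x] P'P] [Q' [oQ' Q'y] Q'Q].
have [i [Bx BP]] := bB _ _ oP' P'x; have [j [Cy CQ]] := bC _ _ oQ' Q'y.
exists (pickle (i, j)); rewrite pickleK /=; split => // -[a b] /= [Ba Cb].
by apply: PQ; split => /=; [exact/P'P/BP|exact/Q'Q/CQ].
Qed.

Lemma nat_base_open (T : topologicalType) (B : nat -> set T) (U : set T) :
  nat_base B -> open U -> U = \bigcup_(i in [set i | B i `<=` U]) B i.
Proof.
move=> [_ bB] oU; apply/seteqP; split => x.
  by move=> Ux; have [i [Bx BU]] := bB _ _ oU Ux; exists i.
by move=> [i BU]; exact: BU.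
Qed.

(** Regularity of uniform spaces fits the closure of a base set between a point and [U]; hence open
    sets are countable unions of closed sets. *)
Lemma nat_base_open_closure (T : uniformType) (B : nat -> set T) (U : set T) :
  nat_base B -> open U ->
  U = \bigcup_(i in [set i | closure (B i) `<=` U]) closure (B i).
Proof.
move=> [_ bB] oU; apply/seteqP; split => x; last by move=> [i BU]; exact: BU.
move=> Ux; have [W Wx WU] := uniform_regular (open_nbhs_nbhs (conj oU Ux)).
move: Wx; rewrite nbhsE => -[W' [oW' W'x] W'W].
have [i [Bx BW]] := bB _ _ oW' W'x; exists i; last exact: subset_closure.
by apply: subset_trans WU; apply: closureS; exact: subset_trans W'W.
Qed.

Lemma rV_rat_dense (R : realType) (n : nat) (x : 'rV[R]_n) (e : R) : 0 < e ->
  exists c : 'rV[rat]_n, ball x e (map_mx (@ratr R) c).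
Proof.
move=> e0.
have /choice [f Hf] : forall j, exists q : rat, ball (x ord0 j) e (ratr q : R).
  move=> j; have /rat_in_itvoo[q] : (x ord0 j - e < x ord0 j + e) by lra.
  rewrite in_itv /= => /andP[q1 q2]; exists q.
  by rewrite /ball /= ltr_norml; apply/andP; split; lra.
exists (\row_j f j); split => // i j; rewrite !mxE ord1; exact: Hf.
Qed.

Lemma rV_nat_base (R : realType) (n : nat) :
  exists B : nat -> set 'rV[R]_n, nat_base B.
Proof.
apply: (@count_nat_base _ ('rV[rat]_n * rat)%type
  (fun i => ball (map_mx (@ratr R) i.1) (ratr i.2))).
  by move=> i; exact: (@ball_open R 'rV[R]_n).
move=> x U oU Ux.
have /nbhs_ballP [e /= e0 eU] : nbhs x U by exact: open_nbhs_nbhs.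
have /rat_in_itvoo[r] : 0 < e / 2 by rewrite divr_gt0.
rewrite in_itv /= => /andP[r0 re].
have [c /ball_sym xc] := rV_rat_dense x r0.
exists (c, r); split => /=.
  exact: xc.
move=> y cy; apply: eU.
apply: (@le_ball _ _ x (ratr r + ratr r)); first by lra.
by apply: (ball_triangle _ cy); exact/ball_sym.
Qed.

(** * Regularity of Borel probability measures, and supports *)

(** Continuity from above along the decreasing sets [A] minus the first [N] sets of the family. *)
Lemma approx_bigcup d (T : measurableType d) (R : realType)
    (P : probability T R) (A : set T) (F : nat -> set T) (e : R) :
  measurable A -> (forall i, measurable (F i)) ->
  (P (A `\` \bigcup_i F i) < e%:E)%E ->
  exists N, (P (A `\` \big[setU/set0]_(i < N) F i) < e%:E)%E.
Proof.
move=> mA mF Pe.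
have mD N : measurable (A `\` \big[setU/set0]_(i < N) F i).
  by apply: measurableD => //; exact: bigsetU_measurable.
have := @nonincreasing_cvg_mu _ _ _ P
  (fun N => A `\` \big[setU/set0]_(i < N) F i).
have -> : \bigcap_n (A `\` \big[setU/set0]_(i < n) F i) = A `\` \bigcup_i F i.
  apply/seteqP; split => x.
    move=> H; split; first by have [] := H 0%N I.
    move=> [i _ Fx]; have [_] := H i.+1 I; apply.
    by rewrite big_ord_recr; right.
  move=> [Ax nFx] N _; split => //; rewrite -bigcup_mkord => -[i _ Fx].
  by apply: nFx; exists i.
move=> /(_ _ mD) cv.
have : (P \o (fun N => A `\` \big[setU/set0]_(i < N) F i)) @ \oo -->
    P (A `\` \bigcup_i F i).
  apply: cv.
  - by apply: le_lt_trans (probability_le1 P (mD _)) _; rewrite ltry.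
  - by apply: measurableD => //; exact: bigcupT_measurable.
  - move=> m k mk; rewrite subsetEset; apply: setDS => x.
    by rewrite -!bigcup_mkord => -[i /= im Fx]; exists i => //=; exact: leq_trans mk.
move=> /(_ [set x | (x < e%:E)%E]) H.
have : nbhs (P (A `\` \bigcup_i F i)) [set x | (x < e%:E)%E].
  by apply: open_nbhs_nbhs; split => //; exact: open_ereal_lt_ereal.
by move=> /H [N _ /(_ N (leqnn _))] /=; exists N.
Qed.

(** The sets that can be approximated in this way form a sigma-algebra containing the open sets. *)
Lemma borel_regular (R : realType) (n : nat) (P : probability (Rn R n) R)
    (A : set (Rn R n)) (e : R) : measurable A -> 0 < e ->
  exists F O : set 'rV[R]_n, [/\ closed F, open O, F `<=` A, A `<=` O &
    (P (O `\` F : set (Rn R n)) < e%:E)%E].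
Proof.
have oM (O : set 'rV[R]_n) : open O -> measurable (O : set (Rn R n)).
  by move=> oO; exact: sub_sigma_algebra.
have cM (O : set 'rV[R]_n) : closed O -> measurable (O : set (Rn R n)).
  by move=> cO; rewrite -(setCK O); apply: measurableC; apply: oM; exact: closed_openC.
move=> mA; move: e; move: A mA.
pose C := [set A : set 'rV[R]_n | forall e : R, 0 < e ->
  exists F O : set 'rV[R]_n, [/\ closed F, open O, F `<=` A, A `<=` O &
    (P (O `\` F : set (Rn R n)) < e%:E)%E]].
suff : <<s @open 'rV[R]_n >> `<=` C by [].
apply: smallest_sub; [split|].
- move=> e e0; exists set0, set0; split => //.
  + exact: closed0.
  + by rewrite setD0 measure0 lte_fin.
- move=> A CA e /CA [F [ O [cF oO FA AO PO]]]; rewrite setTD.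
  exists (~` O), (~` F); split.
  + exact: open_closedC.
  + exact: closed_openC.
  + exact: subsetC.
  + exact: subsetC.
  + by rewrite setDE setCK setIC -setDE.
- move=> A CA e e0.
  have e20 : 0 < e / 2 by rewrite divr_gt0.
  have /choice [F HF] : forall i, exists F, exists O : set 'rV[R]_n,
      [/\ closed F, open O, F `<=` A i, A i `<=` O &
      (P (O `\` F : set (Rn R n)) < (e / 2 / (2 ^ i.+1)%:R)%:E)%E].
    by move=> i; apply: CA; rewrite divr_gt0// ltr0n expn_gt0.
  have {HF}/choice [ O HO] := HF.
  have oU : open (\bigcup_i O i) by apply: bigcup_open => i _; have [] := HO i.
  have mF i : measurable (F i : set (Rn R n)) by have [/cM] := HO i.
  have mO i : measurable (O i : set (Rn R n)) by have [_ /oM] := HO i.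
  (* An infinite union of closed sets need not be closed, so only finitely many [F i] are kept.
     Errors summing to [e / 2] leave room for the strict bound. *)
  have [|N HN] := @approx_bigcup _ _ _ P (\bigcup_i O i) F e (oM _ oU) mF.
    apply: (@le_lt_trans _ _ (e / 2)%:E); last by rewrite lte_fin; lra.
    apply: (@le_trans _ _ (\sum_(i <oo) P (O i `\` F i : set (Rn R n)))%E).
      apply: measure_sigma_subadditive.
      + by move=> i; exact: measurableD.
      + by apply: measurableD; [exact: oM|exact: bigcupT_measurable].
      + move=> x [[i _ Ox] nFx]; exists i => //; split => // Fx.
        by apply: nFx; exists i.
    apply: (@le_trans _ _ (\sum_(i <oo) (e / 2 / (2 ^ i.+1)%:R)%:E)%E).
      by apply: lee_nneseries => // i _; apply: ltW; have [] := HO i.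
    by apply: (epsilon_trick0 xpredT); exact: ltW.
  exists (\big[setU/set0]_(i < N) F i), (\bigcup_i O i); split => //.
  + rewrite -bigcup_mkord; apply: closed_bigcup => //.
      by move=> i _; have [] := HO i.
  + rewrite -bigcup_mkord => x [i _ Fx]; exists i => //.
    by have [_ _ FA _ _] := HO i; exact: FA.
  + by move=> x [i _ Ax]; exists i => //; have [_ _ _ AO _] := HO i; exact: AO.
- move=> U oU e e0; have [B bB] := rV_nat_base R n.
  pose D i := if `[< closure (B i) `<=` U >] then closure (B i) else set0.
  have cD i : closed (D i).
    by rewrite /D; case: asboolP => _; [exact: closed_closure|exact: closed0].
  have UD : U = \bigcup_i D i.
    rewrite {1}(nat_base_open_closure bB oU) bigcup_mkcond.
    apply: eq_bigcupr => i _; rewrite /D; case: asboolP => H.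
      by rewrite mem_set.
    by rewrite memNset.
  have [||N HN] := @approx_bigcup _ (Rn R n) _ P U D e (oM _ oU).
    by move=> i; exact: cM.
    by rewrite -UD setDv measure0 lte_fin.
  exists (\big[setU/set0]_(i < N) D i), U; split => //.
  + by rewrite -bigcup_mkord; apply: closed_bigcup.
  + by rewrite -bigcup_mkord => x [i _ Dx]; rewrite UD; exists i.
Qed.

Lemma compact_nat_cover (T : topologicalType) (K : set T) (O : nat -> set T) :
  compact K -> (forall i, open (O i)) -> K `<=` \bigcup_i O i ->
  exists N, K `<=` \big[setU/set0]_(i < N) O i.
Proof.
rewrite compact_near_coveringP => cK oO KO.
have [x Kx|N _ HN] := cK nat \oo (fun N x => (\big[setU/set0]_(i < N) O i) x) _.
  have [i _ Ox] := KO x Kx.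
  exists (O i, [set N | (i < N)%N]) => /=.
    by split; [exact: open_nbhs_nbhs|exists i.+1].
  by move=> [y N] /= [Oy iN]; rewrite -bigcup_mkord; exists i.
by exists N; exact: HN (leqnn _).
Qed.

(** Serves to cut out a null set by an open set of small measure, so that what is left of a closed
    set stays closed. *)
Lemma null_open_cover (R : realType) (n : nat) (P : probability (Rn R n) R)
    (A : set (Rn R n)) (e : R) : measurable A -> P A = 0%E -> 0 < e ->
  exists U : set 'rV[R]_n, [/\ open U, A `<=` U & (P (U : set (Rn R n)) < e%:E)%E].
Proof.
move=> mA PA e0; have [F [ O [cF oO FA AO PO]]] := borel_regular P mA e0.
exists O; split => //; apply: le_lt_trans PO.
have mO : measurable (O : set (Rn R n)) by exact: sub_sigma_algebra.
have mF : measurable (F : set (Rn R n)).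
  rewrite -(setCK F); apply: measurableC; apply: sub_sigma_algebra.
  exact: closed_openC.
apply: (@le_trans _ _ (P (O `\` F : set (Rn R n)) + P A)%E); last by rewrite PA adde0.
apply: (@le_trans _ _ (P ((O `\` F) `|` A : set (Rn R n)))).
  apply: le_measure; [exact: mem_set|apply: mem_set|].
    by apply: (@measurableU _ (Rn R n)) => //; exact: measurableD.
  by move=> x Ox; have [Fx|nFx] := pselect (F x); [right; exact: FA|left].
by apply: measureU2 => //; exact: measurableD.
Qed.

(** For a countable base, the complement of this union is the topological support, which therefore
    has full measure. *)
Lemma null_base_union d (T : measurableType d) (R : realType)
    (P : probability T R) (B : nat -> set T) :
  (forall i, measurable (B i)) ->
  let N := \bigcup_(i in [set i | P (B i) = 0%E]) B i in
  measurable N /\ P N = 0%E.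
Proof.
move=> mB N.
have mN : measurable N by exact: bigcup_measurable.
split => //; apply/eqP; rewrite eq_le measure_ge0 andbT.
pose C i := if `[< P (B i) = 0%E >] then B i else set0.
have mC i : measurable (C i) by rewrite /C; case: ifP.
apply: le_trans (_ : (\sum_(i <oo) P (C i) <= 0)%E).
  apply: measure_sigma_subadditive => // x [i /= Pi Bx]; exists i => //.
  by rewrite /C asboolT.
rewrite eseries0// => i _ _; rewrite /C.
by case: asboolP => // _; rewrite measure0.
Qed.

Lemma prob_setC0 d (T : measurableType d) (R : realType)
    (P : probability T R) (A : set T) :
  measurable A -> P (~` A) = 0%E -> P A = 1%E.
Proof. by move=> mA H; rewrite -(setCK A) probability_setC ?H ?sube0//; exact: measurableC. Qed.

Lemma prob_setC1 d (T : measurableType d) (R : realType)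
    (P : probability T R) (A : set T) :
  measurable A -> P A = 1%E -> P (~` A) = 0%E.
Proof. by move=> mA H; rewrite probability_setC ?H ?subee. Qed.

Section R3.
Variables (R : realType) (n : nat).
Local Notation V := 'rV[R]_n.
Local Notation V3 := ((V * V) * V)%type.

Lemma open_Rn (U : set V) : open U -> measurable (U : set (Rn R n)).
Proof. by move=> oO; exact: sub_sigma_algebra. Qed.

Lemma closed_Rn (U : set V) : closed U -> measurable (U : set (Rn R n)).
Proof.
by move=> cU; rewrite -(setCK U); apply: measurableC; apply: open_Rn; exact: closed_openC.
Qed.

(** The base consists of boxes with open, hence Borel, sides; this is why open sets of the product
    topology belong to the product sigma-algebra. *)
Lemma V3_base : exists B : nat -> set V3, nat_base B /\
  forall i, exists A1 A2 A3 : set V, [/\ open A1, open A2, open A3 &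
    B i = (A1 `*` A2) `*` A3].
Proof.
have [B bB] := rV_nat_base R n.
have [p bp] := prod_nat_base bB bB.
have [q bq] := prod_nat_base bp bB.
eexists; split; first exact: bq.
move=> i; exists (B (p (q i).1).1), (B (p (q i).1).2), (B (q i).2).
by split => //; exact: bB.1.
Qed.

Lemma open_T3 (U : set V3) : open U -> measurable (U : set (T3 R n)).
Proof.
move=> oU; have [B [bB rB]] := V3_base.
rewrite (nat_base_open bB oU); apply: bigcup_measurable => i _.
have [A1 [A2 [A3 [p1 p2 p3 ->]]]] := rB i.
by apply: measurableX; first apply: measurableX; exact: open_Rn.
Qed.

Lemma closed_T3 (U : set V3) : closed U -> measurable (U : set (T3 R n)).
Proof.
by move=> cU; rewrite -(setCK U); apply: measurableC; apply: open_T3; exact: closed_openC.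
Qed.

Lemma continuous_T3 (f : V3 -> R) : continuous f ->
  measurable_fun setT (f : T3 R n -> R).
Proof.
move=> cf; apply: (measurability _ (measurable_realfun.RGenOpens.measurableE R)).
move=> _ [_ [a [b ->] <-]]; rewrite setTI; apply: open_T3.
by move/continuousP : cf; apply; exact: interval_open.
Qed.

Lemma msupport_full (P : probability (Rn R n) R) :
  closed (msupport P) /\ P (msupport P : set (Rn R n)) = 1%E.
Proof.
have [B [oB bB]] := rV_nat_base R n.
have [mN PN] := @null_base_union _ (Rn R n) _ P B (fun i => open_Rn (oB i)).
have E : msupport P =
    ~` (\bigcup_(i in [set i | P (B i : set (Rn R n)) = 0%E]) B i).
  apply/seteqP; split => x.
    by move=> Sx [i /= Pi Bx]; have := Sx _ (oB i) Bx; rewrite Pi ltxx.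
  move=> nBx U oU Ux; rewrite measure_gt0; apply/eqP => PU.
  have [i [Bx BU]] := bB _ _ oU Ux; apply: nBx; exists i => //=.
  apply/eqP; rewrite eq_le measure_ge0 andbT -PU.
  by apply: le_measure => //; apply: mem_set; exact: open_Rn.
split; first by rewrite E; apply: open_closedC; exact: bigcup_open.
rewrite E; apply: prob_setC0; first exact: measurableC.
by rewrite setCK.
Qed.

End R3.

(** * Lipschitz graphs and monotone correspondences *)

Definition dotmul (R : realType) (n : nat) (u v : 'rV[R]_n) : R :=
  \sum_(j < n) u ord0 j * v ord0 j.

(** Such a set is part of the graph of a function giving coordinate [i] from the others, Lipschitz
    with constant 3 for the l1 norm. The constant is the one produced by [cone_lip]. *)
Definition lip_graph (R : realType) (n : nat) (i : 'I_n) (A : set 'rV[R]_n) :=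
  forall x y, A x -> A y -> `|x ord0 i - y ord0 i| <=
    3 * \sum_(j < n.-1) `|x ord0 (lift i j) - y ord0 (lift i j)|.

Lemma sum_prefix (R : realType) (v : R) (C K : nat) : 0 <= v ->
  \sum_(k < K) (if (k < C)%N then v else 0) <= C%:R * v.
Proof.
move=> v0.
have -> : \sum_(k < K) (if (k < C)%N then v else 0) = (minn K C)%:R * v.
  elim: K => [|K ih]; first by rewrite big_ord0 min0n mul0r.
  rewrite big_ord_recr/= ih; case: ifPn => [KC|].
    by rewrite (minn_idPl (ltnW KC)) (minn_idPl KC) -natr1 mulrDl mul1r.
  rewrite -leqNgt => KC.
  by rewrite (minn_idPr KC) (minn_idPr (leq_trans KC (leqnSn _))) addr0.
by rewrite ler_wpM2r// ler_nat geq_minr.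
Qed.

(** Over each cell of a grid of mesh [h] in the other [m] coordinates, the graph fits in a box of
    height [6 * m%:R * h]. There are about [h ^- m] cells, so the total volume is of order [h]. *)
Lemma lip_graph_null (R : realType) (n : nat) (i : 'I_n) (A : set 'rV[R]_n)
    (c : 'rV[R]_n) (r : R) : 0 < r ->
  (forall x, A x -> forall j, `|x ord0 j - c ord0 j| <= r) ->
  lip_graph i A -> lebesgue_null A.
Proof.
move=> r0 Ar Alip eps eps0.
pose m := n.-1.
(* The boxes will have total volume at most [(4 * r) ^+ m * (6 * m%:R) * h] with [h = 2 * r / N%:R];
   this is at most [eps] as soon as [K <= N%:R]. *)
pose K : R := (4 * r) ^+ m * (6 * m%:R) * (2 * r) / eps.
have K0 : 0 <= K.
  apply: divr_ge0 (ltW eps0); apply: mulr_ge0; last lra.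
  by apply: mulr_ge0; [apply: exprn_ge0; lra|exact: mulr_ge0].
pose N := (Num.Def.archi_bound K).+1.
have N0 : 0 < N%:R :> R by rewrite ltr0n.
have KN : K <= N%:R.
  by apply: (le_trans (ltW (archi_boundP K0))); rewrite ler_nat.
pose h := 2 * r / N%:R.
have h0 : 0 < h by rewrite divr_gt0// mulr_gt0.
(* Cell indices run up to [N] included, since a point on the upper face of the cube is rounded down
   to index [N]. *)
pose F : finType := {ffun 'I_m -> 'I_N.+1}.
pose cell (f : F) : set 'rV[R]_n := [set x | A x /\ forall j, 0 <= x ord0 (lift i j) -
   (c ord0 (lift i j) - r + (f j)%:R * h) <= h].
(* A point of [A] over the cell fixes the height of its box; a cell without such a point gets the
   default [c]. After the last cell the boxes degenerate to the point [c]. *)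
pose xf (f : F) := xget c (cell f).
pose lo (f : F) : 'rV[R]_n := \row_k if unlift i k is Some j then
  c ord0 (lift i j) - r + (f j)%:R * h else xf f ord0 i - 3 * m%:R * h.
pose hi (f : F) : 'rV[R]_n := \row_k if unlift i k is Some j then
  c ord0 (lift i j) - r + (f j)%:R * h + h else xf f ord0 i + 3 * m%:R * h.
pose f0 : F := [ffun => ord0].
pose en k := nth f0 (enum F) k.
pose a k := if (k < #|F|)%N then lo (en k) else c.
pose b k := if (k < #|F|)%N then hi (en k) else c.
have mh : 0 <= 3 * m%:R * h by apply: mulr_ge0 (ltW h0); exact: mulr_ge0.
exists a, b; split; [|split].
- move=> k j; rewrite /a /b; case: ifP => // _; rewrite !mxE.
  case: unlift => [j'|]; last lra.
  by rewrite lerDl ltW.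
- move=> x Ax.
  pose f : F := [ffun j => inord (Num.truncn
    ((x ord0 (lift i j) - c ord0 (lift i j) + r) / h))].
  have cx : cell f x.
    split => // j; rewrite ffunE.
    set y := x ord0 (lift i j) - c ord0 (lift i j) + r.
    have := Ar x Ax (lift i j); rewrite ler_norml => /andP[y1 y2].
    have y0 : 0 <= y / h by rewrite divr_ge0 ?(ltW h0)// /y; lra.
    have yN : y / h <= N%:R.
      rewrite ler_pdivrMr// /h mulrC divfK ?gt_eqF// /y; lra.
    rewrite inordK; last first.
      rewrite truncn_lt_nat//; apply: le_lt_trans yN _; rewrite ltr_nat//.
    have /andP[t1 t2] := truncn_itv y0.
    rewrite ler_pdivlMr// in t1; rewrite ltr_pdivrMr// in t2.
    move: t1 t2; set t := Num.truncn _; rewrite -natr1 /y => t1 t2.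
    by apply/andP; split; lra.
  exists (enum_rank f) => //.
  have fE : en (enum_rank f) = f by rewrite /en nth_enum_rank.
  rewrite /a /b ltn_ord fE => k; rewrite !mxE.
  case: unliftP => [j ->|->].
    by have [_ /(_ j)/andP[]] := cx => ? ?; apply/andP; split; lra.
  have cxf : cell f (xf f) by apply: xgetPex; exists x.
  have [Axf Hxf] := cxf.
  have := Alip x (xf f) Ax Axf.
  have : \sum_(j < n.-1) `|x ord0 (lift i j) - xf f ord0 (lift i j)| <= m%:R * h.
    apply: (@le_trans _ _ (\sum_(j < m) h)).
      apply: ler_sum => j _; have [_ /(_ j)/andP[? ?]] := cx.
      have /andP[? ?] := Hxf j; rewrite ler_norml; apply/andP; split; lra.
    by rewrite sumr_const card_ord mulr_natl lexx.
  move=> H1 H2; have H : `|x ord0 i - xf f ord0 i| <= 3 * m%:R * h.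
    by apply: le_trans H2 _; rewrite -mulrA ler_wpM2l.
  by move: H; rewrite ler_norml => /andP[? ?]; apply/andP; split; lra.
- move=> M.
  pose v := 6 * m%:R * h * h ^+ m.
  have hm0 : 0 <= h ^+ m by apply: exprn_ge0; exact: ltW.
  have v0 : 0 <= v by apply: mulr_ge0 => //; apply: mulr_ge0 (ltW h0); exact: mulr_ge0.
  apply: (@le_trans _ _ (\sum_(k < M) (if (k < #|F|)%N then v else 0))).
    apply: ler_sum => k _; rewrite /a /b; case: ifP => _.
      rewrite /box_vol (bigD1_ord i)//= !mxE unlift_none.
      under eq_bigr do rewrite !mxE liftK.
      rewrite (eq_bigr (fun=> h)); last by move=> j _; lra.
      rewrite prodr_const card_ord /v -/m.
      by apply: ler_wpM2r => //; lra.
    by rewrite /box_vol (bigD1 i)//= subrr mul0r.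
  apply: le_trans (sum_prefix _ _ v0) _.
  rewrite card_ffun !card_ord natrX.
  have Nh : N.+1%:R * h <= 4 * r.
    rewrite /h mulrA ler_pdivrMr// -natr1.
    have : 1 <= N%:R :> R by rewrite ler1n.
    by move=> ?; nra.
  have -> : N.+1%:R ^+ m * v = (N.+1%:R * h) ^+ m * (6 * m%:R) * h.
    rewrite /v [(N.+1%:R * h) ^+ m]exprMn -/m.
    by move: (N.+1%:R ^+ m) (h ^+ m) => p q; ring.
  apply: (@le_trans _ _ ((4 * r) ^+ m * (6 * m%:R) * h)).
    rewrite ler_wpM2r ?(ltW h0)// ler_wpM2r ?mulr_ge0//.
    by apply: lerXn2r => //; rewrite nnegrE ?mulr_ge0 ?(ltW h0) ?(ltW r0).
  rewrite /h mulrA ler_pdivrMr// [eps * _]mulrC.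
  by move: KN; rewrite /K ler_pdivrMr.
Qed.

Lemma exists_argmax (R : realType) (n : nat) (v : 'I_n -> R) (i0 : 'I_n) :
  exists i, forall j, v j <= v i.
Proof.
exists [arg max_(i > i0) v i]%O; case: arg_maxP => // i _ H j; exact: H.
Qed.

(** With [S] the sum over the other coordinates, isolating [v i * d i] bounds [|v i| |d i|] by
    [|v i| / 2 (|d i| + S) + |v i| S], which amounts to [|d i| <= 3 S]. *)
Lemma cone_lip (R : realType) (n : nat) (v d : 'I_n -> R) (i : 'I_n) (dl : R) :
  `|\sum_j v j * d j| <= 2 * dl * \sum_j `|d j| ->
  (forall j, `|v j| <= `|v i|) -> 4 * dl <= `|v i| -> 0 < `|v i| ->
  `|d i| <= 3 * \sum_(j < n.-1) `|d (lift i j)|.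
Proof.
move=> H vi dlv v0.
have H1 : \sum_j v j * d j = v i * d i + \sum_(j < n.-1) v (lift i j) * d (lift i j).
  by rewrite (bigD1_ord i).
have H2 : \sum_j `|d j| = `|d i| + \sum_(j < n.-1) `|d (lift i j)|.
  by rewrite (bigD1_ord i).
have H3 : `|\sum_(j < n.-1) v (lift i j) * d (lift i j)| <=
    `|v i| * \sum_(j < n.-1) `|d (lift i j)|.
  apply: le_trans (ler_norm_sum _ _ _) _; rewrite mulr_sumr.
  by apply: ler_sum => j _; rewrite normrM ler_wpM2r.
set S := \sum_(j < n.-1) `|d (lift i j)| in H2 H3 *.
have S0 : 0 <= S by apply: sumr_ge0.
have H4 : `|v i| * `|d i| <= `|\sum_j v j * d j| +
    `|\sum_(j < n.-1) v (lift i j) * d (lift i j)|.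
  rewrite -normrM H1; set a := v i * d i; set b := \sum_(j < n.-1) _.
  have := ler_normB (a + b) b; rewrite addrK; lra.
have H5 : 2 * dl * (`|d i| + S) <= `|v i| / 2 * (`|d i| + S).
  by apply: ler_wpM2r; [exact: addr_ge0|lra].
rewrite H2 in H.
have H6 : `|v i| * `|d i| <= `|v i| * (3 * S) by nra.
by rewrite -(ler_pM2l v0).
Qed.

(** The inequality is a closed condition in each point separately, so it passes to the closure one
    point at a time. Taking closures makes the exceptional sets Borel. *)
Lemma closed_lip_graph (R : realType) (n : nat) (i : 'I_n) (A : set 'rV[R]_n) :
  lip_graph i A -> lip_graph i (closure A).
Proof.
have cc (y : 'rV[R]_n) : closed [set x : 'rV[R]_n | `|x ord0 i - y ord0 i| <=
    3 * \sum_(j < n.-1) `|x ord0 (lift i j) - y ord0 (lift i j)|].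
  pose f (x : 'rV[R]_n) := 3 * \sum_(j < n.-1)
    `|x ord0 (lift i j) - y ord0 (lift i j)| - `|x ord0 i - y ord0 i|.
  rewrite (_ : [set x | _] = f @^-1` [set z | 0 <= z]); last first.
    by apply/seteqP; split => x; rewrite /= /f subr_ge0.
  have cj k x : {for x, continuous (fun z : 'rV[R]_n => `|z ord0 k - y ord0 k|)}.
    apply: cont_at_norm; apply: cont_at_add; last exact: cont_at_cst.
    exact: coord_continuous.
  have cf x : {for x, continuous f}.
    rewrite /f; apply: cont_at_add; last by apply: cont_at_opp; exact: cj.
    by apply: cont_at_mul; [exact: cont_at_cst|apply: cont_at_sum => j; exact: cj].
  by apply: closed_comp => [x _|]; [exact: cf|exact: closed_ge].
move=> H x y Ax Ay.
have st (C : set 'rV[R]_n) : closed C -> A `<=` C -> closure A `<=` C.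
  by move=> cC AC z; rewrite closureEbigcap => /(_ C); apply.
have H1 y' : A y' -> forall x', closure A x' -> `|x' ord0 i - y' ord0 i| <=
    3 * \sum_(j < n.-1) `|x' ord0 (lift i j) - y' ord0 (lift i j)|.
  by move=> Ay'; apply: (st _ (cc y')) => z Az; exact: H.
have := st _ (cc x) _ y Ay; rewrite /= => H2.
rewrite distrC; under eq_bigr do rewrite distrC.
apply: H2 => z Az /=.
rewrite distrC; under eq_bigr do rewrite distrC.
exact: H1.
Qed.

(* If the gradients P at x and x' take values near p and near q, monotonicity
   bounds (p - q).(x - x') by a small multiple of |x - x'|; so the points with
   two gradients near p and q lie on a Lipschitz graph in the coordinate where
   p - q is largest. *)
Lemma monotone_null (R : realType) (n : nat) (W : Type)
    (G : 'rV[R]_n -> W -> Prop) (g : 'rV[R]_n -> W -> R)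
    (P : 'rV[R]_n -> W -> 'rV[R]_n) :
  (forall x x' w, dotmul (P x' w) (x - x') <= g x w - g x' w) ->
  (forall x w x' w', G x w -> G x' w' ->
    g x w + g x' w' <= g x w' + g x' w) ->
  (forall x w, G x w -> {for x, continuous (fun x' => P x' w)}) ->
  exists N : set (Rn R n), [/\ measurable N,
    forall mu : probability (Rn R n) R, leb_abs_cont mu -> mu N = 0%E &
    forall x w0 w1, G x w0 -> G x w1 -> ~ N x -> P x w0 = P x w1].
Proof.
move=> subg mono cont.
(* Rational parameters, hence countably many: a ball of centre [cc] and radius [rr], two gradient
   values [pp] and [qq], and a tolerance [dd]. *)
pose I := (('rV[rat]_n * 'rV[rat]_n * 'rV[rat]_n) * (rat * rat))%type.
pose cc (t : I) := map_mx (@ratr R) t.1.1.1.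
pose pp (t : I) := map_mx (@ratr R) t.1.1.2.
pose qq (t : I) := map_mx (@ratr R) t.1.2.
pose rr (t : I) := ratr t.2.1 : R.
pose dd (t : I) := ratr t.2.2 : R.
(* The bounds are asked on the whole ball because monotonicity evaluates the gradient for the
   parameter of one point at the other point. *)
pose A (t : I) : set 'rV[R]_n := [set x | ball (cc t) (rr t) x /\
  exists w0 w1, [/\ G x w0, G x w1,
    (forall x', ball (cc t) (rr t) x' ->
      forall j, `|P x' w0 ord0 j - pp t ord0 j| <= dd t) &
    (forall x', ball (cc t) (rr t) x' ->
      forall j, `|P x' w1 ord0 j - qq t ord0 j| <= dd t)]].
pose ok (t : I) := 0 < rr t /\ exists i, [/\
  forall j, `|pp t ord0 j - qq t ord0 j| <= `|pp t ord0 i - qq t ord0 i|,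
  4 * dd t <= `|pp t ord0 i - qq t ord0 i| &
  0 < `|pp t ord0 i - qq t ord0 i|].
pose F (t : I) : set 'rV[R]_n := if `[< ok t >] then closure (A t) else set0.
(* Two subgradient inequalities and [mono] add up to [P x' w0 . (x - x') + P x w1 . (x' - x) <= 0];
   replacing the gradients by [pp] and [qq] costs twice the tolerance. *)
have half t x x' : A t x -> A t x' ->
    \sum_j (pp t ord0 j - qq t ord0 j) * (x ord0 j - x' ord0 j) <=
    2 * dd t * \sum_j `|x ord0 j - x' ord0 j|.
  move=> [bx [w0 [_ [Gx _ H0 _]]]] [bx' [_ [w1 [_ Gx' _ H1]]]].
  have m := mono _ _ _ _ Gx Gx'.
  have s1 := subg x x' w0; have s2 := subg x' x w1.
  have : dotmul (P x' w0) (x - x') + dotmul (P x w1) (x' - x) <= 0 by lra.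
  rewrite /dotmul -big_split /= => s3.
  rewrite -subr_le0; apply: le_trans s3; rewrite mulr_sumr -sumrB.
  apply: ler_sum => j _.
  have sE (u v : 'rV[R]_n) : (u - v) ord0 j = u ord0 j - v ord0 j by rewrite !mxE.
  rewrite !sE; have := H0 x' bx' j; have := H1 x bx j.
  set d := x ord0 j - x' ord0 j.
  have -> : x' ord0 j - x ord0 j = - d by rewrite /d; ring.
  rewrite !ler_norml => /andP[a1 a2] /andP[b1 b2].
  have : d <= `|d| by exact: ler_norm.
  have : - d <= `|d| by rewrite -normrN ler_norm.
  move: (P x' w0 ord0 j) (P x w1 ord0 j) (pp t ord0 j) (qq t ord0 j) a1 a2 b1 b2.
  move=> a b p q a1 a2 b1 b2 d1 d2.
  have e1 : (p - a) * d <= dd t * `|d|.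
    by apply: le_trans (ler_norm _) _; rewrite normrM ler_wpM2r// ler_norml; apply/andP; split; lra.
  have e2 : (b - q) * d <= dd t * `|d|.
    by apply: le_trans (ler_norm _) _; rewrite normrM ler_wpM2r// ler_norml; apply/andP; split; lra.
  lra.
have null t : ok t -> lebesgue_null (closure (A t)).
  move=> [r0 [i [i1 i2 i3]]].
  apply: (@lip_graph_null _ _ i _ (cc t) (rr t)) => //.
    have st (C : set 'rV[R]_n) : closed C -> A t `<=` C -> closure (A t) `<=` C.
      by move=> cC AC z; rewrite closureEbigcap => /(_ C); apply.
    move=> x Ax j; have cC : closed [set x : 'rV[R]_n | `|x ord0 j - cc t ord0 j| <= rr t].
      have cf z : {for z, continuous (fun x : 'rV[R]_n => `|x ord0 j - cc t ord0 j|)}.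
        apply: cont_at_norm; apply: cont_at_add; last exact: cont_at_cst.
        exact: coord_continuous.
      apply: (@closed_comp _ _ (fun x : 'rV[R]_n => `|x ord0 j - cc t ord0 j|)
        [set z | z <= rr t]); [by move=> z _; exact: cf|exact: closed_le].
    apply: (st _ cC) Ax => z [[_ bz] _] /=; have := bz ord0 j.
    by rewrite /ball /= distrC => /ltW.
  apply: closed_lip_graph => x x' Ax Ax'.
  have := @cone_lip _ _ (fun j => pp t ord0 j - qq t ord0 j)
    (fun j => x ord0 j - x' ord0 j) i (dd t) _ i1 i2 i3.
  apply; rewrite ler_norml; apply/andP; split; last exact: half.
  rewrite lerNl; have := half _ _ _ Ax' Ax.
  under [X in _ <= _ * X]eq_bigr do rewrite distrC.
  rewrite (_ : \sum_j _ * (x' ord0 j - _) = - \sum_j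
    (pp t ord0 j - qq t ord0 j) * (x ord0 j - x' ord0 j))//.
  by rewrite -sumrN; apply: eq_bigr => j _; ring.
pose FF k := if unpickle k is Some t then F t else set0.
have cFF k : closed (FF k).
  rewrite /FF; case: unpickle => [t|]; last exact: closed0.
  by rewrite /F; case: asboolP => _; [exact: closed_closure|exact: closed0].
have mFF k : measurable (FF k : set (Rn R n)) by exact: closed_Rn.
exists (\bigcup_k FF k); split.
- exact: bigcupT_measurable.
- move=> mu ac; apply/eqP; rewrite eq_le measure_ge0 andbT.
  pose FF' : nat -> set (Rn R n) := FF.
  have := @measure_sigma_subadditive _ _ (Rn R n) mu _ FF' mFF
    (bigcupT_measurable _ mFF) (fun x H => H).
  move=> /le_trans; apply.
  rewrite eseries0// => k _ _.
  have := mFF k; rewrite /FF' /FF; case: unpickle => [t|]; last by move=> _; exact: (@measure0 _ (Rn R n) _ mu).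
  rewrite /F; case: asboolP => [okt mc|]; last by move=> _ _; exact: (@measure0 _ (Rn R n) _ mu).
  by apply: ac => //; exact: null.
- move=> x w0 w1 G0 G1 nN; apply: contrapT => neq; apply: nN.
  suff [t [okt At]] : exists t, ok t /\ A t x.
    exists (pickle t); first exact: Logic.I.
    rewrite /FF pickleK /F asboolT//.
    exact: subset_closure.
have nearP w : G x w -> forall e : R, 0 < e ->
      exists2 r, 0 < r & forall x', ball x r x' ->
      forall j, `|P x' w ord0 j - P x w ord0 j| <= e.
    move=> Gx e e0; have := cont _ _ Gx _ (nbhsx_ballx _ _ e0).
    rewrite /= => /nbhs_ballP [r /= r0 rP]; exists r => // x' /rP [_ H] j.
    by have := H ord0 j; rewrite /ball /= distrC => /ltW.
  have [i0 vi0] : exists i, P x w0 ord0 i - P x w1 ord0 i != 0.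
    apply: contrapT => H; apply: neq; apply/rowP => j.
    apply/eqP; rewrite -subr_eq0; apply/negPn/negP => H'.
    by apply: H; exists j.
  have m0 : 0 < `|P x w0 ord0 i0 - P x w1 ord0 i0| by rewrite normr_gt0.
  set m := `|_| in m0.
  (* The tolerance is below a tenth of the gap [m], half of it for rounding the gradients to
     rationals and half for their variation on the ball. The rounded values still differ by
     [9 * dl], beyond the required [4 * dl]. *)
  have /rat_in_itvoo[dl] : 0 < m / 10 by lra.
  rewrite in_itv /= => /andP[dl0 dlm].
  have dl20 : 0 < ratr dl / 2 :> R by lra.
  have [p [_ Hp]] := rV_rat_dense (P x w0) dl20.
  have [q [_ Hq]] := rV_rat_dense (P x w1) dl20.
  have {}Hp j : `|P x w0 ord0 j - map_mx (@ratr R) p ord0 j| <= ratr dl / 2.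
    exact/ltW/(Hp ord0 j).
  have {}Hq j : `|P x w1 ord0 j - map_mx (@ratr R) q ord0 j| <= ratr dl / 2.
    exact/ltW/(Hq ord0 j).
  have [r0 r00 Hr0] := nearP _ G0 _ dl20.
  have [r1 r10 Hr1] := nearP _ G1 _ dl20.
  (* The rational centre is within [r] of [x], so its ball of radius [r] lies in the ball of radius
     [2 r] around [x], where both gradients vary little. *)
  have /rat_in_itvoo[r] : 0 < Num.min r0 r1 / 2.
    by rewrite divr_gt0// lt_min r00.
  rewrite in_itv /= => /andP[rp rm].
  have rr0 : ratr r + ratr r <= r0.
    have : Num.min r0 r1 <= r0 by rewrite ge_min lexx.
    lra.
  have rr1 : ratr r + ratr r <= r1.
    have : Num.min r0 r1 <= r1 by rewrite ge_min lexx orbT.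
    lra.
  have [c xc] := rV_rat_dense x rp.
  have sub x' : ball (map_mx (@ratr R) c) (ratr r) x' ->
      ball x (ratr r + ratr r) x'.
    by move=> H; exact: ball_triangle xc H.
  exists (c, p, q, (r, dl)); split; [split|split].
  + by [].
  + have [i Hi] := exists_argmax
      (fun j => `|map_mx (@ratr R) p ord0 j - map_mx (@ratr R) q ord0 j|) i0.
    have mi : 9 * ratr dl <=
        `|map_mx (@ratr R) p ord0 i - map_mx (@ratr R) q ord0 i|.
      apply: le_trans (Hi i0).
      have := Hp i0; have := Hq i0; move: dlm; rewrite /m.
      move: (P x w0 ord0 i0) (P x w1 ord0 i0) (map_mx _ p ord0 i0)
        (map_mx _ q ord0 i0) (ratr dl : R) => a b u v z z1 z2 z3.
      have : `|a - b| <= `|a - u| + `|u - v| + `|b - v|.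
        rewrite [`|b - v|]distrC.
        apply: le_trans (lerD (ler_normD _ _) (lexx _)).
        apply: le_trans (ler_normD _ _).
        by rewrite (_ : a - b = a - u + (u - v) + (v - b))//; ring.
      lra.
    by exists i; split => //; rewrite /dd /pp /qq /=; lra.
  + exact/ball_sym.
  + exists w0, w1; split => // x' /sub bx' j; rewrite /dd /pp /qq /=.
      have := Hr0 x' (le_ball rr0 bx') j; have := Hp j.
      move: (P x' w0 ord0 j) (P x w0 ord0 j) (map_mx _ p ord0 j) => a b u h1 h2.
      have := ler_normD (a - b) (b - u); rewrite subrKA.
    lra.
    have := Hr1 x' (le_ball rr1 bx') j; have := Hq j.
    move: (P x' w1 ord0 j) (P x w1 ord0 j) (map_mx _ q ord0 j) => a b u h1 h2.
    have := ler_normD (a - b) (b - u); rewrite subrKA.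
    lra.
Qed.

(** * Existence of an optimal plan *)

(** For [t >= 0] the sum is [t] rounded up to a multiple of [dl] and truncated at [N%:R * dl]. The
    strict test makes the layers of a continuous function open. *)
Lemma step_ge (R : realType) (t dl : R) (N : nat) : 0 < dl ->
  Num.min t (N%:R * dl) <= \sum_(j < N) (if j%:R * dl < t then dl else 0).
Proof.
move=> d0; elim: N => [|N ih]; first by rewrite big_ord0 mul0r ge_min lexx orbT.
rewrite big_ord_recr/= -natr1 mulrDl mul1r; case: ltP => H.
  rewrite ge_min; apply/orP; right; rewrite lerD2r.
  by apply: le_trans ih; rewrite le_min lexx ltW.
by rewrite addr0; apply: le_trans ih; rewrite (min_l H) ge_min lexx.
Qed.

Lemma step_le (R : realType) (t dl : R) (N : nat) : 0 < dl -> 0 <= t ->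
  \sum_(j < N) (if j%:R * dl < t then dl else 0) <= t + dl.
Proof.
move=> d0 t0; elim: N => [|N ih]; first by rewrite big_ord0 addr_ge0// ltW.
rewrite big_ord_recr/=; case: ltP => H; last by rewrite addr0.
rewrite lerD2r; apply: le_trans (ltW H).
elim: N {ih H} => [|N ih]; first by rewrite big_ord0 mul0r.
by rewrite big_ord_recr/= -natr1 mulrDl mul1r lerD//; case: ifP => // _; exact: ltW.
Qed.

(** * Layer-cake bounds for integrals *)

Section layers.
Context d (T : measurableType d) (R : realType) (P : probability T R).
Variables (f : T -> R) (dl : R) (N : nat).
Hypotheses (mf : measurable_fun setT f) (f0 : forall x, 0 <= f x) (d0 : 0 < dl).

Let step x : R := \sum_(j < N) (if j%:R * dl < f x then dl else 0).

Let mlayer (j : nat) : measurable [set x | j%:R * dl < f x].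
Proof.
have -> : [set x | j%:R * dl < f x] = f @^-1` `]j%:R * dl, +oo[%classic.
  by apply/seteqP; split => x /=; rewrite in_itv/= andbT.
by rewrite -[X in measurable X]setTI; exact: mf.
Qed.

Let stepE x : step x = \sum_(j < N) dl * \1_[set x | j%:R * dl < f x] x.
Proof.
apply: eq_bigr => j _; rewrite indicE; case: ifPn => H.
  by rewrite mem_set// mulr1.
by rewrite memNset ?mulr0//=; apply/negP.
Qed.

Let mstep : measurable_fun setT (EFin \o step).
Proof.
apply/measurable_EFinP.
rewrite (_ : step = fun x => \sum_(j < N) dl * \1_[set x | j%:R * dl < f x] x).
  by apply: measurable_sum => j; exact: measurable_funM.
by apply/funext => x; exact: stepE.
Qed.

Let step0 x : 0 <= step x.
Proof. by apply: sumr_ge0 => j _; case: ifP => // _; exact: ltW. Qed.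

Let intstep : (\int[P]_x (step x)%:E)%E =
  (\sum_(j < N) dl * fine (P [set x | j%:R * dl < f x]))%:E.
Proof.
under eq_integral do rewrite stepE -sumEFin.
rewrite ge0_integral_sum//; last 2 first.
- by move=> j; apply/measurable_EFinP; exact: measurable_funM.
- by move=> j x _; rewrite lee_fin mulr_ge0// ltW.
rewrite -sumEFin; apply: eq_bigr => j _.
rewrite (@integralZl_indic _ _ _ _ _ _ (fun=> [set x | j%:R * dl < f x]) dl)//;
  last by move=> /(lt_trans d0); rewrite ltxx.
rewrite integral_indic// setIT EFinM fineK//.
by apply: fin_num_measure.
Qed.

(** On [K], which has full measure, the staircase is not affected by its truncation at
    [N%:R * dl]. *)
Lemma layer_ge (K : set T) : P (~` K) = 0%E -> measurable K ->
  (forall x, K x -> f x <= N%:R * dl) ->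
  (\int[P]_x (f x)%:E <=
   (\sum_(j < N) dl * fine (P [set x | (j%:R * dl < f x)%R]))%:E)%E.
Proof.
move=> PK mK fK; rewrite -intstep; apply: ae_ge0_le_integral => //.
- by move=> x _; rewrite lee_fin.
- exact/measurable_EFinP.
- by move=> x _; rewrite lee_fin.
exists (~` K); split => //; first exact: measurableC.
move=> x /= H Kx; apply: H => _; rewrite lee_fin.
apply: le_trans (step_ge _ _ d0).
by rewrite le_min lexx/=; exact: fK.
Qed.

Lemma layer_le :
  ((\sum_(j < N) dl * fine (P [set x | (j%:R * dl < f x)%R]))%:E <=
   \int[P]_x (f x)%:E + dl%:E)%E.
Proof.
rewrite -intstep.
have -> : dl%:E = (\int[P]_x (cst dl%:E x))%E.
  by rewrite integral_cst//= [X in (_ * X)%E](probability_setT P) mule1.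
rewrite -ge0_integralD//=; last 3 first.
- by move=> x _; rewrite lee_fin.
- exact/measurable_EFinP.
- by move=> x _; rewrite lee_fin ltW.
apply: ge0_le_integral => //.
- by move=> x _; rewrite lee_fin.
- by apply: emeasurable_funD => //; exact/measurable_EFinP.
- by move=> x _; rewrite -EFinD lee_fin; exact: step_le.
Qed.

End layers.

(** * Continuity and measurability of the cost *)

Section cost_facts.
Variables (R : realType) (n : nat).
Local Notation V := 'rV[R]_n.
Local Notation V3 := ((V * V) * V)%type.

Lemma enorm_ge0 (x : V) : 0 <= enorm x.
Proof. exact: sqrtr_ge0. Qed.

Lemma enorm_sqr (x : V) : enorm x ^+ 2 = \sum_(j < n) x ord0 j ^+ 2.
Proof. by rewrite sqr_sqrtr// sumr_ge0// => j _; exact: sqr_ge0. Qed.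

Lemma enorm_cont (T : topologicalType) (u v : T -> V) (x : T) :
  {for x, continuous u} -> {for x, continuous v} ->
  {for x, continuous (fun t => enorm (u t - v t))}.
Proof.
move=> cu cv; rewrite /enorm; apply: cont_at_sqrt; apply: cont_at_sum => j.
have c : {for x, continuous (fun t => (u t - v t) ord0 j)}.
  rewrite (_ : (fun t => _) = fun t => u t ord0 j + - v t ord0 j); last first.
    by apply/funext => t; rewrite !mxE.
  by apply: cont_at_add; [|apply: cont_at_opp]; exact: cont_at_coord.
exact: cont_at_mul.
Qed.

Lemma cost3_ge0 (p : T3 R n) : 0 <= cost3 p.
Proof. by rewrite /cost3 !addr_ge0 ?enorm_ge0 ?sqr_ge0. Qed.

Lemma cost3_cont_at (T : topologicalType) (u v w : T -> V) (x : T) :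
  {for x, continuous u} -> {for x, continuous v} -> {for x, continuous w} ->
  {for x, continuous (fun t => cost3 ((u t, v t), w t))}.
Proof.
move=> cu cv cw; rewrite /cost3 /=.
apply: cont_at_add; first apply: cont_at_add.
- exact: enorm_cont.
- by apply: cont_at_mul; exact: enorm_cont.
- by apply: cont_at_mul; exact: enorm_cont.
Qed.

Lemma cont_x : continuous (fun p : V3 => p.1.1).
Proof. by move=> p; apply: continuous_comp; exact: cvg_fst. Qed.
Lemma cont_y : continuous (fun p : V3 => p.1.2).
Proof. by move=> p; apply: continuous_comp; [exact: cvg_fst|exact: cvg_snd]. Qed.
Lemma cont_z : continuous (fun p : V3 => p.2).
Proof. by move=> p; exact: cvg_snd. Qed.

Lemma cost3_continuous : continuous (@cost3 R n : V3 -> R).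
Proof.
move=> p; have cx : {for p, continuous (fun p : V3 => p.1.1)} by exact: cont_x.
have cy : {for p, continuous (fun p : V3 => p.1.2)} by exact: cont_y.
have cz : {for p, continuous (fun p : V3 => p.2)} by exact: cont_z.
have H := cost3_cont_at cx cy cz.
by rewrite (_ : (fun t => _) = (@cost3 R n : V3 -> R)) in H.
Qed.

Lemma measurable_cost3 : measurable_fun setT (@cost3 R n).
Proof. exact: continuous_T3 cost3_continuous. Qed.

End cost_facts.

(** * Limits of sequences of couplings *)

Section coupling_limit.
Variables (R : realType) (n : nat) (mu nu ga : probability (Rn R n) R).
Local Notation V := 'rV[R]_n.
Local Notation V3 := ((V * V) * V)%type.

Definition supp3 : set V3 := (msupport mu `*` msupport nu) `*` msupport ga.

Lemma measurable_x : measurable_fun setT (fun p : T3 R n => p.1.1).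
Proof. by apply: measurableT_comp. Qed.
Lemma measurable_y : measurable_fun setT (fun p : T3 R n => p.1.2).
Proof. by apply: measurableT_comp. Qed.
Lemma measurable_z : measurable_fun setT (fun p : T3 R n => p.2).
Proof. exact: measurable_snd. Qed.

Lemma measurable_cyl (f : T3 R n -> Rn R n) (A : set (Rn R n)) :
  measurable_fun setT f -> measurable A -> measurable (f @^-1` A).
Proof. by move=> mf mA; rewrite -[X in measurable X]setTI; exact: mf. Qed.

Lemma measurable_supp3 : measurable (supp3 : set (T3 R n)).
Proof.
have ms (m : probability (Rn R n) R) : measurable (msupport m : set (Rn R n)).
  by apply: closed_Rn; have [] := msupport_full m.
by apply: measurableX; first apply: measurableX; exact: ms.
Qed.

Lemma coupling_supp3 (lam : probability (T3 R n) R) :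
  coupling3 mu nu ga lam -> lam (supp3 : set (T3 R n)) = 1%E.
Proof.
move=> [cx [cy cz]]; apply: prob_setC0; first exact: measurable_supp3.
have S (m : probability (Rn R n) R) :
    measurable (~` msupport m : set (Rn R n)) /\ m (~` msupport m) = 0%E.
  have [cl m1] := msupport_full m.
  have ms : measurable (msupport m : set (Rn R n)) by exact: closed_Rn.
  by split; [exact: measurableC|exact: prob_setC1].
have [mx ex] := S mu; have [my ey] := S nu; have [mz ez] := S ga.
have := cx _ mx; have := cy _ my; have := cz _ mz; rewrite ex ey ez.
have Mx := measurable_cyl measurable_x mx.
have My := measurable_cyl measurable_y my.
have Mz := measurable_cyl measurable_z mz.
move=> Ez Ey Ex.
apply/eqP; rewrite eq_le measure_ge0 andbT.
have E : ~` (supp3 : set (T3 R n)) `<=`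
    ((fun p : T3 R n => p.1.1) @^-1` (~` msupport mu) `|`
    (fun p : T3 R n => p.1.2) @^-1` (~` msupport nu)) `|`
    (fun p : T3 R n => p.2) @^-1` (~` msupport ga).
  move=> p; apply: contra_notP => /not_orP[/not_orP[/contrapT h1 /contrapT h2] /contrapT h3].
  by [].
apply: le_trans (le_measure lam _ _ E) _.
- by apply: mem_set; apply: measurableC; exact: measurable_supp3.
- by apply: mem_set; apply: measurableU => //; exact: measurableU.
apply: le_trans (measureU2 _ _ _) _ => //; first exact: measurableU.
rewrite [X in (_ + X)%E]Ez adde0.
apply: le_trans (measureU2 _ _ _) _ => //.
by rewrite [X in (_ + X)%E]Ey [X in (X + _)%E]Ex adde0.
Qed.

Hypotheses (cX : compact (msupport mu)) (cY : compact (msupport nu))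
  (cZ : compact (msupport ga)).

Lemma compact_supp3 : compact supp3.
Proof. by apply: compact_setX => //; exact: compact_setX. Qed.

Variable lam_ : nat -> probability (T3 R n) R.
Hypothesis couple : forall k, coupling3 mu nu ga (lam_ k).

(** A form of weak compactness. The ultralimit [w] of the plans has the prescribed values on
    cylinders, which brings it within reach of the extension theorem, and [P] is at most [w] on open
    sets. Nonnegative combinations of open sets are what the layer-cake bounds supply. *)
Lemma coupling_limit : exists P : probability (T3 R n) R,
  coupling3 mu nu ga P /\
  forall (m : nat) (c : 'I_m -> R) (U : 'I_m -> set V3) (b : R),
    (forall j, 0 <= c j) -> (forall j, open (U j)) ->
    (\forall k \near \oo, \sum_(j < m) c j * fine (lam_ k (U j : set (T3 R n))) <= b) ->
    \sum_(j < m) c j * fine (P (U j : set (T3 R n))) <= b.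
Proof.
(* The value 0 on nonmeasurable sets keeps the sequence in the unit interval for every index. *)
pose a k (A : set (T3 R n)) : R := if `[< measurable A >] then fine (lam_ k A) else 0.
have a01 k A : 0 <= a k A <= 1.
  rewrite /a; case: asboolP => mA; last by rewrite lexx ler01.
  rewrite fine_ge0//= -lee_fin fineK; first exact: probability_le1.
  exact: fin_num_measure.
have aE k A : measurable A -> a k A = fine (lam_ k A) by move=> mA; rewrite /a asboolT.
have [w Hw] := exists_ultralimit a01.
have w_ge0 A : 0 <= w A.
  have := Hw 1%N (fun=> -1) (fun=> A) 0; rewrite big_ord1 mulN1r oppr_le0.
  apply; near=> k; rewrite big_ord1 mulN1r oppr_le0.
  by have /andP[] := a01 k A.
have w_cst A r : (forall k, a k A = r) -> w A = r.
  move=> H; apply/eqP; rewrite eq_le; apply/andP; split.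
    have := Hw 1%N (fun=> 1) (fun=> A) r; rewrite big_ord1 mul1r; apply.
    by near=> k; rewrite big_ord1 mul1r H.
  have := Hw 1%N (fun=> -1) (fun=> A) (- r).
  rewrite big_ord1 mulN1r lerN2; apply.
  by near=> k; rewrite big_ord1 mulN1r lerN2 H.
(* Additivity is split into two linear inequalities in three terms, each of which passes to the
   limit. *)
have w_add A B : measurable A -> measurable B -> A `&` B = set0 ->
    w (A `|` B) = w A + w B.
  move=> mA mB AB.
  have E k : a k (A `|` B) = a k A + a k B.
    rewrite !aE//; last exact: measurableU.
    rewrite [lam_ k _](measureU _ mA mB AB) fineD//; exact: fin_num_measure.
  apply/eqP; rewrite eq_le; apply/andP; split.
    have := Hw 3%N (fun i => [:: 1; -1; -1]`_i)
      (fun i => nth set0 [:: A `|` B; A; B] i) 0.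
    rewrite !big_ord_recl big_ord0 /= mul1r !mulN1r addr0 => H.
    suff : w (A `|` B) + (- w A + - w B) <= 0 by lra.
    by apply: H; near=> k; rewrite !big_ord_recl big_ord0 /= E; lra.
  have := Hw 3%N (fun i => [:: -1; 1; 1]`_i)
    (fun i => nth set0 [:: A `|` B; A; B] i) 0.
  rewrite !big_ord_recl big_ord0 /= !mul1r mulN1r addr0 => H.
  suff : - w (A `|` B) + (w A + w B) <= 0 by lra.
  by apply: H; near=> k; rewrite !big_ord_recl big_ord0 /= E; lra.
have wT : w setT = 1.
  by apply: w_cst => k; rewrite aE// probability_setT.
have wK : w supp3 = 1.
  apply: w_cst => k; rewrite aE; last exact: measurable_supp3.
  by rewrite coupling_supp3.
have ck (U : nat -> set V3) : (forall i, open (U i)) ->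
    supp3 `<=` \bigcup_i U i ->
    exists N, supp3 `<=` \big[setU/set0]_(i < N) U i.
  exact: compact_nat_cover compact_supp3.
pose L := @LimitContent _ (T3 R n) R (fun U => open (U : set V3)) w supp3
  (@open_T3 R n) (@openT V3) (@open0 V3) (@openU V3) (@openI V3)
  w_ge0 wT w_add measurable_supp3 wK ck.
(* On a cylinder every plan takes the value of the marginal, so [w] does too, and regularity of the
   marginal provides the approximating sets. *)
have cyl (f : V3 -> V) (m : probability (Rn R n) R) : continuous f ->
    measurable_fun setT (f : T3 R n -> Rn R n) ->
    (forall k (A : set (Rn R n)), measurable A ->
      lam_ k (f @^-1` A : set (T3 R n)) = m A) ->
    forall A : set (Rn R n), measurable A ->
      lc_approx L (f @^-1` A) /\ w (f @^-1` A) = fine (m A).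
  move=> cf mf Hm A mA; split; last first.
    by apply: w_cst => k; rewrite aE ?Hm//; exact: measurable_cyl mf mA.
  split; first exact: measurable_cyl mf mA.
  move=> e e0; have [F [ U [cF oU FA AU PU]]] := borel_regular m mA e0.
  exists (f @^-1` F), (f @^-1` U); split.
  - rewrite preimage_setC; apply: open_comp; last exact: closed_openC.
    by move=> x _; exact: cf.
  - by apply: open_comp => // x _; exact: cf.
  - exact: preimage_subset.
  - exact: preimage_subset.
  - have mD : measurable (U `\` F : set (Rn R n)).
      by apply: measurableD; [exact: open_Rn|exact: closed_Rn].
    rewrite [lc_val L _](_ : _ = fine (m (U `\` F : set (Rn R n)))).
      rewrite -lee_fin fineK; first exact: ltW.
      exact: fin_num_measure.
    change (w (f @^-1` (U `\` F)) = fine (m (U `\` F : set (Rn R n)))).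
    by apply: w_cst => k; rewrite aE ?Hm//; exact: measurable_cyl mf mD.
have cx := cyl _ mu (@cont_x R n) measurable_x (fun k => (couple k).1).
have cy := cyl _ nu (@cont_y R n) measurable_y (fun k => (couple k).2.1).
have cz := cyl _ ga (@cont_z R n) measurable_z (fun k => (couple k).2.2).
have sub : @measurable _ (T3 R n) `<=` <<s lc_approx L >>.
  pose S := g_sigma_algebraType (lc_approx L : set (set (T3 R n))).
  have mid : measurable_fun setT (id : S -> T3 R n).
    apply/measurable_fun_pairP; split; [apply/measurable_fun_pairP; split|].
    - move=> _ A mA; rewrite setTI; apply: sub_sigma_algebra.
      by have [] := cx _ mA.
    - move=> _ A mA; rewrite setTI; apply: sub_sigma_algebra.
      by have [] := cy _ mA.
    - move=> _ A mA; rewrite setTI; apply: sub_sigma_algebra.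
      by have [] := cz _ mA.
  by move=> A mA; have := mid measurableT A mA; rewrite setTI.
have [P PE] := limit_content_extension sub.
(* Finitely many boxes inside [U] carry almost all of [P U]; their union lies in the approximation
   algebra, where [P] and [w] agree. *)
have PU (U : set V3) : open U -> fine (P (U : set (T3 R n))) <= w U.
  move=> oU; apply/ler_addgt0Pr => e e0.
  have [B [bB rB]] := V3_base R n.
  pose D i : set (T3 R n) := if `[< B i `<=` U >] then B i else set0.
  have LB i : lc_approx L (B i).
    have [A1 [A2 [A3 [p1 p2 p3 ->]]]] := rB i.
    have -> : (A1 `*` A2) `*` A3 = ~` ((~` ((fun p : V3 => p.1.1) @^-1` A1) `|`
       ~` ((fun p : V3 => p.1.2) @^-1` A2)) `|` ~` ((fun p : V3 => p.2) @^-1` A3)).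
      by rewrite !setCU !setCK.
    apply: lc_approxC; apply: lc_approxU; first apply: lc_approxU;
      apply: lc_approxC.
    - by have [] := cx _ (open_Rn p1).
    - by have [] := cy _ (open_Rn p2).
    - by have [] := cz _ (open_Rn p3).
  have LD i : lc_approx L (D i).
    by rewrite /D; case: asboolP => _ //; exact: lc_approx0.
  have mD i : measurable (D i) by have [] := LD i.
  have UD : U = \bigcup_i D i.
    rewrite {1}(nat_base_open bB oU) bigcup_mkcond.
    apply: eq_bigcupr => i _; rewrite /D; case: asboolP => H.
      by rewrite mem_set.
    by rewrite memNset.
  have mU : measurable (U : set (T3 R n)) by exact: open_T3.
  have [|N PN] := @approx_bigcup _ _ _ P U D e mU mD.
    by rewrite -UD setDv measure0 lte_fin.
  set C := \big[setU/set0]_(i < N) D i in PN.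
  have LC : lc_approx L C.
    rewrite /C; elim: N {PN C} => [|N ih].
      by rewrite big_ord0; exact: lc_approx0.
    by rewrite big_ord_recr; exact: lc_approxU.
  have mC : measurable C by have [] := LC.
  have CU : C `<=` U.
    by rewrite /C -bigcup_mkord UD => x [i _ Dx]; exists i.
  have wCU : w C <= w U by exact: (@lc_le _ _ _ L).
  have : (P U <= (w U + e)%:E)%E.
    have -> : P (U : set (T3 R n)) = (P C + P (U `\` C))%E.
      rewrite -[in LHS](setDUK CU) [LHS]measureU//; first exact: measurableD.
      exact: setDIK.
    by rewrite PE// EFinD leeD//; exact: ltW.
  rewrite -lee_fin fineK//; exact: fin_num_measure.
exists P; split.
  have cpl (f : T3 R n -> Rn R n) (m : probability (Rn R n) R) A :
      lc_approx L (f @^-1` A) /\ w (f @^-1` A) = fine (m A) ->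
      measurable A -> P (f @^-1` A) = m A.
    move=> [LA wA] mA; rewrite PE// [lc_val L _]wA fineK//.
    exact: fin_num_measure.
  by split; [|split] => A mA; apply: cpl => //; [exact: cx|exact: cy|exact: cz].
move=> m c U b c0 oU H.
apply: (@le_trans _ _ (\sum_(j < m) c j * w (U j))).
  by apply: ler_sum => j _; rewrite ler_wpM2l//; exact: PU.
apply: Hw; apply: filterS H => k.
rewrite [X in _ -> X <= _](_ : _ =
  \sum_(j < m) c j * fine (lam_ k (U j : set (T3 R n))))//.
by apply: eq_bigr => j _; rewrite aE//; exact: open_T3.
Unshelve. all: by end_near. Qed.

End coupling_limit.

(** * Minimization of the cost over couplings *)

Section existence.
Variables (R : realType) (n : nat) (mu nu ga : probability (Rn R n) R).
Local Notation V := 'rV[R]_n.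
Local Notation V3 := ((V * V) * V)%type.

(** The product of the three marginals; it ensures that the infimum runs over a nonempty set. *)
Lemma exists_coupling : exists lam : probability (T3 R n) R, coupling3 mu nu ga lam.
Proof.
have pT d1 d2 (T1 : measurableType d1) (T2 : measurableType d2)
    (m1 : probability T1 R) (m2 : probability T2 R) :
    exists m : probability (T1 * T2)%type R, forall A B, measurable A ->
    measurable B -> m (A `*` B) = (m1 A * m2 B)%E.
  have mT : (m1 \x m2)%E setT = 1%E.
    rewrite -setXTT product_measure1E//.
    by rewrite [X in (X * _)%E](probability_setT m1) [X in (_ * X)%E](probability_setT m2) mule1.
  have [m Hm] := exists_pushforward mT (@measurable_id _ _ _).
  by exists m => A B mA mB; rewrite Hm preimage_id; exact: product_measure1E.
have [m Hm] := pT _ _ _ _ mu nu.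
have [lam Hlam] := pT _ _ _ _ m ga.
exists lam; split; [|split] => A mA.
- rewrite (_ : _ @^-1` A = (A `*` setT) `*` setT); last first.
    by apply/seteqP; split => x //= [[]].
  rewrite Hlam//; last exact: measurableX.
  by rewrite Hm// !probability_setT !mule1.
- rewrite (_ : _ @^-1` A = (setT `*` A) `*` setT); last first.
    by apply/seteqP; split => x //= [[]].
  rewrite Hlam//; last exact: measurableX.
  by rewrite Hm// !probability_setT mule1 mul1e.
- rewrite (_ : _ @^-1` A = setT `*` A); last first.
    by apply/seteqP; split => x //= [].
  by rewrite Hlam// probability_setT mul1e.
Qed.

Hypotheses (cX : compact (msupport mu)) (cY : compact (msupport nu))
  (cZ : compact (msupport ga)).

Lemma cost3_bounded : exists2 M, 0 < M &
  forall p : V3, supp3 mu nu ga p -> (cost3 (p : T3 R n)) <= M.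
Proof.
have ck := compact_supp3 cX cY cZ.
have : compact [set cost3 (p : T3 R n) | p in supp3 mu nu ga].
  apply: (@continuous_compact V3 R) => //.
  by apply: continuous_subspaceT; exact: cost3_continuous.
move=> /compact_bounded [M [_ HM]].
exists (`|M| + 1); first by rewrite ltr_wpDl.
move=> p Sp; apply: le_trans (ler_norm _) _; apply: HM; last by exists p.
by rewrite (le_lt_trans (ler_norm M))// ltrDl.
Qed.

Lemma total_cost_bounded : exists2 M, 0 < M & forall lam : probability (T3 R n) R,
  coupling3 mu nu ga lam -> (0 <= total_cost lam <= M%:E)%E.
Proof.
have [M M0 HM] := cost3_bounded; exists M => // lam clam.
rewrite /total_cost integral_ge0/=; last by move=> p _; rewrite lee_fin cost3_ge0.
have -> : M%:E = (\int[lam]_p (cst M%:E p))%E.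
  by rewrite integral_cst//= [X in (_ * X)%E](probability_setT lam) mule1.
apply: ae_ge0_le_integral => //.
- by move=> p _; rewrite lee_fin cost3_ge0.
- by apply/measurable_EFinP; exact: measurable_cost3.
- by move=> p _; rewrite lee_fin ltW.
have mS := @measurable_supp3 R n mu nu ga.
exists (~` (supp3 mu nu ga : set (T3 R n))); split => //.
- exact: measurableC.
- by apply: prob_setC1 => //; exact: coupling_supp3.
- by move=> p /= H Sp; apply: H => _; rewrite lee_fin; exact: HM.
Qed.

(** The layers of the cost are open, and on open sets the limit coupling can only lose mass; so the
    layer-cake sums of a minimizing sequence bound the cost of its limit. *)
Lemma exists_optimal : exists lam : probability (T3 R n) R,
  optimal_plan mu nu ga lam.
Proof.
have [M M0 HM] := total_cost_bounded.
have [C C0 HC] := cost3_bounded.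
have fin lam : coupling3 mu nu ga lam -> total_cost lam \is a fin_num.
  move=> /HM /andP[h1 h2]; rewrite ge0_fin_numE//; exact: le_lt_trans h2 (ltry _).
pose S := [set x | exists2 lam : probability (T3 R n) R, coupling3 mu nu ga lam &
  x = fine (total_cost lam)].
have infS : has_inf S.
  split; first by have [lam cl] := exists_coupling; exists (fine (total_cost lam)), lam.
  by exists 0 => x [lam /HM /andP[h _] ->]; exact: fine_ge0.
have /choice [lam_ Hlam] : forall k : nat, exists lam : probability (T3 R n) R,
    coupling3 mu nu ga lam /\ fine (total_cost lam) < inf S + k.+1%:R^-1.
  move=> k; have k0 : 0 < k.+1%:R^-1 :> R by rewrite invr_gt0.
  by have [x [lam cl ->] Hx] := inf_adherent k0 infS; exists lam.
have [P [cP HP]] := coupling_limit cX cY cZ (fun k => (Hlam k).1).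
exists P; split => // lam' cl'.
rewrite -(fineK (fin _ cP)) -(fineK (fin _ cl')) lee_fin.
apply: (@le_trans _ _ (inf S)); last first.
  by apply: ge_inf; [exact: infS.2|exists lam'].
(* One half of [e] pays for rounding the cost to multiples of [dl], the other for the distance of
   the minimizing sequence to the infimum. *)
apply/ler_addgt0Pr => e e0; pose dl := e / 2.
have d0 : 0 < dl by rewrite divr_gt0.
pose N := Num.Def.archi_bound (C / dl).
have CN : C <= N%:R * dl.
  rewrite -ler_pdivrMr//; apply: ltW; apply: archi_boundP.
  by rewrite divr_ge0// ltW.
have oU (j : 'I_N) : open [set p : V3 | j%:R * dl < cost3 (p : T3 R n)].
  apply: (@open_comp V3 R (@cost3 R n) [set y | j%:R * dl < y]).
    by move=> x _; exact: cost3_continuous.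
  exact: open_gt.
have step k := @layer_le _ _ _ (lam_ k) _ dl N (@measurable_cost3 R n)
  (@cost3_ge0 R n) d0.
have B : \sum_(j < N) dl * fine (P [set p : T3 R n | j%:R * dl < cost3 p])
    <= inf S + e.
  apply: (HP N (fun=> dl) (fun j => [set p : V3 | j%:R * dl < cost3 (p : T3 R n)])).
  - by move=> _; exact: ltW.
  - exact: oU.
  near=> k.
  have := step k; rewrite -[(\int[_]_p _)%E]/(total_cost (lam_ k)).
  rewrite -(fineK (fin _ (Hlam k).1)) -EFinD lee_fin => /le_trans; apply.
  have : k.+1%:R^-1 < dl :> R by near: k; exact: near_infty_natSinv_lt (PosNum d0).
  have := (Hlam k).2; move: (fine _) (k.+1%:R^-1) => t u; rewrite /dl => h1 h2; lra.
rewrite -lee_fin fineK; last exact: fin.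
apply: le_trans (_ : (_ <= (\sum_(j < N) dl * fine
  (P [set p : T3 R n | j%:R * dl < cost3 p]))%:E)%E) _; last by rewrite lee_fin.
apply: (layer_ge (@measurable_cost3 R n) (@cost3_ge0 R n) d0
  (K := supp3 mu nu ga)).
- by apply: prob_setC1; [exact: measurable_supp3|exact: coupling_supp3].
- exact: measurable_supp3.
- by move=> p /HC /le_trans; apply.
Unshelve. all: by end_near. Qed.

End existence.

(** * Exchanges between points of the support *)

Lemma mule_half_double (R : realType) (a : \bar R) : (0 <= a)%E ->
  ((2^-1)%:E * (a + a) = a)%E.
Proof.
case: a => [r||] //= _; first by rewrite -EFinD -EFinM; congr EFin; lra.
by rewrite addye// gt0_muley// lte_fin invr_gt0.
Qed.

(** Serves twice: to average the two coordinate laws after an exchange, and to average two optimal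
    plans. *)
Lemma exists_mix d (T : measurableType d) (R : realType) (P Q : probability T R) :
  exists M : probability T R,
  (forall A, M A = ((2^-1)%:E * (P A + Q A))%E) /\
  forall f : T -> \bar R, (forall x, (0 <= f x)%E) -> measurable_fun setT f ->
    (\int[M]_x f x = (2^-1)%:E * (\int[P]_x f x + \int[Q]_x f x))%E.
Proof.
have h0 : 0 <= 2^-1 :> R by rewrite invr_ge0.
pose m : {measure set T -> \bar R} := mscale (NngNum h0) (measure_add P Q).
have mE A : m A = ((2^-1)%:E * (P A + Q A))%E.
  by congr (_ * _)%E; exact: measure_addE.
have mT : m setT = 1%E by rewrite mE !probability_setT mule_half_double.
have [M HM] := exists_pushforward mT (@measurable_id _ _ _).
have ME A : M A = m A by rewrite HM preimage_id.
exists M; split => [A|f f0 mf]; first by rewrite ME mE.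
rewrite (@eq_measure_integral _ _ _ _ m); last by move=> A _ _; exact: ME.
by rewrite ge0_integral_mscale// ge0_integral_measure_add.
Qed.

Lemma ge0_integral_transfer d1 d2 (T1 : measurableType d1) (T2 : measurableType d2)
    (R : realType) (m : {measure set T1 -> \bar R}) (Q : {measure set T2 -> \bar R})
    (f : T1 -> T2) (g : T2 -> \bar R) : measurable_fun setT f ->
  (forall A, measurable A -> Q A = m (f @^-1` A)) ->
  (forall x, (0 <= g x)%E) -> measurable_fun setT g ->
  (\int[Q]_x g x = \int[m]_x g (f x))%E.
Proof.
move=> mf QE g0 mg; have := ge0_integral_pushforward mf m measurableT mg.
rewrite preimage_setT => <-; last by move=> y _; exact: g0.
by apply: eq_measure_integral => A mA _; rewrite QE.
Qed.

Section swap.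
Context d (T : measurableType d) (R : realType) (lam : probability T R).
Variables (c : T -> R) (s : T * T -> T).
Hypotheses (mc : measurable_fun setT c) (c0 : forall p, 0 <= c p)
  (ms : measurable_fun setT s).
Local Notation L2 := (lam \x lam)%E.
Let sw (u : T * T) := (u.2, u.1).
(** The saving when a pair [(p, q)] is replaced by [(s (p, q), s (q, p))]. The exchange is made on
    [W], where the saving is positive. *)
Let gain (u : T * T) := c u.1 + c u.2 - (c (s u) + c (s (sw u))).
Let W (u : T * T) : bool := 0 < gain u.
Let f1 u := if W u then s u else u.1.
Let f2 u := if W u then s (sw u) else u.2.

Let m1 : measurable_fun setT (fst : T * T -> T). Proof. exact: measurable_fst. Qed.
Let m2 : measurable_fun setT (snd : T * T -> T). Proof. exact: measurable_snd. Qed.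
Let msw : measurable_fun setT sw.
Proof. exact: measurable_fun_pair. Qed.
Let mssw : measurable_fun setT (fun u => s (sw u)).
Proof. exact: (measurableT_comp ms msw). Qed.
Let mgain : measurable_fun setT gain.
Proof.
apply: measurable_funB; apply: measurable_funD.
- exact: (measurableT_comp mc m1).
- exact: (measurableT_comp mc m2).
- exact: (measurableT_comp mc ms).
- exact: (measurableT_comp mc mssw).
Qed.
Let mW : measurable_fun setT W.
Proof. by apply: measurable_fun_ltr. Qed.
Let mf1 : measurable_fun setT f1. Proof. exact: measurable_fun_ifT. Qed.
Let mf2 : measurable_fun setT f2. Proof. exact: measurable_fun_ifT. Qed.

Let L2T : L2 setT = 1%E.
Proof.
rewrite -setXTT product_measure1E//.
by rewrite [X in (X * _)%E](probability_setT lam) [X in (_ * X)%E](probability_setT lam) mule1.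
Qed.

Let int1 (g : T -> \bar R) : (forall x, (0 <= g x)%E) -> measurable_fun setT g ->
  (\int[L2]_u g u.1 = \int[lam]_p g p)%E.
Proof.
move=> g0 mg; apply/esym/ge0_integral_transfer => // A mA.
rewrite (_ : fst @^-1` A = A `*` setT); last by apply/seteqP; split => x //= [].
by rewrite [RHS]product_measure1E// [X in (_ * X)%E](probability_setT lam) mule1.
Qed.

Let int2 (g : T -> \bar R) : (forall x, (0 <= g x)%E) -> measurable_fun setT g ->
  (\int[L2]_u g u.2 = \int[lam]_p g p)%E.
Proof.
move=> g0 mg; apply/esym/ge0_integral_transfer => // A mA.
rewrite (_ : snd @^-1` A = setT `*` A); last by apply/seteqP; split => x //= [].
by rewrite [RHS]product_measure1E// [X in (X * _)%E](probability_setT lam) mul1e.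
Qed.

(* Both coordinates of lam x lam have law lam, so replacing (p, q) by the
   exchanged pair wherever this lowers c(p) + c(q), and averaging the two
   coordinate laws, gives a competitor with the same marginals. *)
Lemma swap_competitor : exists lam' : probability T R,
  (forall g : T -> \bar R, (forall x, (0 <= g x)%E) -> measurable_fun setT g ->
    (forall p q, (g (s (p, q)) + g (s (q, p)) = g p + g q)%E) ->
    (\int[lam']_p g p = \int[lam]_p g p)%E) /\
  ((\int[lam]_p (c p)%:E < +oo)%E ->
   (\int[lam]_p (c p)%:E <= \int[lam']_p (c p)%:E)%E ->
   L2 [set u | c (s u) + c (s (u.2, u.1)) < c u.1 + c u.2] = 0%E).
Proof.
have [Q1 HQ1] := exists_pushforward L2T mf1.
have [Q2 HQ2] := exists_pushforward L2T mf2.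
have [lam' [_ intlam']] := exists_mix Q1 Q2.
have intE (g : T -> \bar R) : (forall x, (0 <= g x)%E) -> measurable_fun setT g ->
    (\int[lam']_p g p = (2^-1)%:E * \int[L2]_u (g (f1 u) + g (f2 u)))%E.
  move=> g0 mg; rewrite intlam'//.
  rewrite (ge0_integral_transfer mf1 (fun A _ => HQ1 A))//.
  rewrite (ge0_integral_transfer mf2 (fun A _ => HQ2 A))//.
  rewrite ge0_integralD//.
  - exact: (measurableT_comp mg mf1).
  - exact: (measurableT_comp mg mf2).
have intlam (g : T -> \bar R) : (forall x, (0 <= g x)%E) -> measurable_fun setT g ->
    (\int[lam]_p g p = (2^-1)%:E * \int[L2]_u (g u.1 + g u.2))%E.
  move=> g0 mg; rewrite ge0_integralD//.
  - by rewrite int1// int2// mule_half_double//; exact: integral_ge0.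
  - exact: (measurableT_comp mg m1).
  - exact: (measurableT_comp mg m2).
exists lam'; split.
  move=> g g0 mg Hg; rewrite intE// intlam//; congr (_ * _)%E.
  apply: eq_integral => -[p q] _; rewrite /f1 /f2 /sw /=.
  by case: ifP.
move=> fin opt.
pose h u := if W u then gain u else 0.
have h0 u : 0 <= h u by rewrite /h; case: ifPn => // /ltW.
have mh : measurable_fun setT h by apply: measurable_fun_ifT.
have c0' x : (0 <= (c x)%:E)%E by rewrite lee_fin.
have mc' : measurable_fun setT (EFin \o c) by exact/measurable_EFinP.
have m11 := measurableT_comp mc' mf1.
have m22 := measurableT_comp mc' mf2.
(* The cost of a pair is its cost after the exchange plus the gain on [W]. Optimality and finiteness
   then force the gain to integrate to 0, so that [W] is null. *)
have split : (\int[L2]_u ((c u.1)%:E + (c u.2)%:E) =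
    \int[L2]_u ((c (f1 u))%:E + (c (f2 u))%:E) + \int[L2]_u (h u)%:E)%E.
  rewrite -ge0_integralD//.
  - apply: eq_integral => u _; rewrite -!EFinD; congr EFin.
    by rewrite /f1 /f2 /h /gain; case: ifP => _; lra.
  - by move=> u _; rewrite adde_ge0.
  - exact: emeasurable_funD.
  - by move=> u _; rewrite lee_fin.
  - exact/measurable_EFinP.
set a := (\int[L2]_u ((c (f1 u))%:E + (c (f2 u))%:E))%E in split.
have intc := intlam _ c0' mc'; have intc' := intE _ c0' mc'.
rewrite intc' intc split -/a in opt; rewrite intc split in fin.
have a0 : (0 <= a)%E by apply: integral_ge0 => u _; rewrite adde_ge0.
have hh0 : (0 <= \int[L2]_u (h u)%:E)%E.
  by apply: integral_ge0 => u _; rewrite lee_fin.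
have inth : (\int[L2]_u (h u)%:E = 0)%E.
  clear split intc intc' intE intlam; clearbody a.
  move: fin opt a0 hh0.
  case: a => [a||] //; case: (\int[L2]_u (h u)%:E)%E => [b||] //=.
  - rewrite -EFinD -!EFinM !lee_fin => _ H _ b0; congr EFin; lra.
  - by rewrite addey// gt0_muley ?lte_fin ?invr_gt0.
  - by rewrite addye// gt0_muley ?lte_fin ?invr_gt0.
  - by rewrite addye// gt0_muley ?lte_fin ?invr_gt0.
have : ae_eq L2 setT (EFin \o h) (cst 0%E).
  apply/ae_eq_integral_abs => //; first exact/measurable_EFinP.
  rewrite -[RHS]inth; apply: eq_integral => u _ /=.
  by rewrite ger0_norm.
move=> [N [mN N0 HN]].
apply/eqP; rewrite eq_le measure_ge0 andbT -N0.
apply: le_measure; rewrite ?mem_set//.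
  rewrite (_ : [set u | _] = W @^-1` [set true]).
    by rewrite -[X in measurable X]setTI; exact: mW.
  by apply/seteqP; split => u; rewrite /W /gain /sw /= subr_gt0.
move=> u /= Hu; apply: HN => /= /(_ I).
have Wu : W u by rewrite /W /gain /sw subr_gt0.
by rewrite /h Wu => -[] H; move: Wu; rewrite /W H ltxx.
Qed.

End swap.

(** * The support of a plan *)

Section plan_support.
Variables (R : realType) (n : nat).
Local Notation V := 'rV[R]_n.
Local Notation V3 := ((V * V) * V)%type.

Definition plan_supp (lam : probability (T3 R n) R) : set V3 :=
  [set p | forall U : set V3, open U -> U p -> (0 < lam (U : set (T3 R n)))%E].

Lemma plan_supp_full (lam : probability (T3 R n) R) :
  closed (plan_supp lam) /\ lam (plan_supp lam : set (T3 R n)) = 1%E.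
Proof.
have [B [[oB bB] _]] := V3_base R n.
have [mN PN] := @null_base_union _ (T3 R n) _ lam B (fun i => open_T3 (oB i)).
have E : plan_supp lam =
    ~` (\bigcup_(i in [set i | lam (B i : set (T3 R n)) = 0%E]) B i).
  apply/seteqP; split => x.
    by move=> Sx [i /= Pi Bx]; have := Sx _ (oB i) Bx; rewrite Pi ltxx.
  move=> nBx U oU Ux; rewrite measure_gt0; apply/eqP => PU.
  have [i [Bx BU]] := bB _ _ oU Ux; apply: nBx; exists i => //=.
  apply/eqP; rewrite eq_le measure_ge0 andbT -PU.
  by apply: le_measure => //; apply: mem_set; exact: open_T3.
split; first by rewrite E; apply: open_closedC; exact: bigcup_open.
rewrite E; apply: prob_setC0; first exact: measurableC.
by rewrite setCK.
Qed.

Definition pick2 (T : Type) (b : bool) (u : T * T) : T := if b then u.2 else u.1.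

(** A true flag takes the coordinate from the second point; the values at [(p, q)] and [(q, p)] are
    the two points after exchanging the flagged coordinates. *)
Definition swap3 (bx b_y bz : bool) (u : V3 * V3) : V3 :=
  (((pick2 bx u).1.1, (pick2 b_y u).1.2), (pick2 bz u).2).

Lemma swap3C bx b_y bz u :
  swap3 bx b_y bz (u.2, u.1) = swap3 (~~ bx) (~~ b_y) (~~ bz) u.
Proof. by rewrite /swap3 /pick2; case: bx; case: b_y; case: bz. Qed.

Lemma measurable_swap3 bx b_y bz : measurable_fun setT
  (swap3 bx b_y bz : T3 R n * T3 R n -> T3 R n).
Proof.
have mp b : measurable_fun setT (@pick2 (T3 R n) b).
  by case: b; [exact: measurable_snd|exact: measurable_fst].
apply: (measurable_fun_pair (T1 := (Rn R n * Rn R n)%type) (T2 := Rn R n)).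
  apply: (measurable_fun_pair (T1 := Rn R n) (T2 := Rn R n)).
  - exact: (measurableT_comp (@measurable_x R n) (mp bx)).
  - exact: (measurableT_comp (@measurable_y R n) (mp b_y)).
- exact: (measurableT_comp (@measurable_z R n) (mp bz)).
Qed.

Lemma cost_swap3_cont bx b_y bz (u : V3 * V3) :
  {for u, continuous (fun u => cost3 (swap3 bx b_y bz u : T3 R n))}.
Proof.
have cp b : continuous (@pick2 V3 b).
  by move=> v; case: b; [exact: cvg_snd|exact: cvg_fst].
apply: (@cost3_cont_at R n (V3 * V3)%type (fun u => (pick2 bx u).1.1)
  (fun u => (pick2 b_y u).1.2) (fun u => (pick2 bz u).2)).
- exact: (continuous_comp (cp bx u) (@cont_x R n _)).
- exact: (continuous_comp (cp b_y u) (@cont_y R n _)).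
- exact: (continuous_comp (cp bz u) (@cont_z R n _)).
Qed.

Variables (mu nu ga : probability (Rn R n) R).
Hypotheses (cX : compact (msupport mu)) (cY : compact (msupport nu))
  (cZ : compact (msupport ga)).

(** If the exchange lowered the cost at [(p, q)], by continuity it would do so on a product of
    neighbourhoods. This has positive mass for [lam \x lam], as both points lie in the support,
    whereas optimality makes the mass 0. *)
Lemma optimal_swap (lam : probability (T3 R n) R) bx b_y bz (p q : V3) :
  optimal_plan mu nu ga lam -> plan_supp lam p -> plan_supp lam q ->
  cost3 (p : T3 R n) + cost3 (q : T3 R n) <=
  cost3 (swap3 bx b_y bz (p, q) : T3 R n) + cost3 (swap3 bx b_y bz (q, p) : T3 R n).
Proof.
move=> [cl opt] Sp Sq; rewrite leNgt; apply/negP => lt.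
pose s : T3 R n * T3 R n -> T3 R n := swap3 bx b_y bz.
have [lam' [marg Hlam']] := swap_competitor lam (@measurable_cost3 R n)
  (@cost3_ge0 R n) (measurable_swap3 bx b_y bz).
(* An exchange keeps or permutes the values of each coordinate at the two points, so indicators of
   cylinders have invariant sums and the competitor keeps the marginals. *)
have mE (f : T3 R n -> Rn R n) (A : set (Rn R n)) : measurable_fun setT f ->
    (forall u v, (f (s (u, v)) = f u /\ f (s (v, u)) = f v) \/
      (f (s (u, v)) = f v /\ f (s (v, u)) = f u)) ->
    measurable A -> lam' (f @^-1` A) = lam (f @^-1` A).
  move=> mf Hf mA; have mfA : measurable (f @^-1` A) by exact: measurable_cyl.
  have := marg (fun x => (\1_(f @^-1` A) x)%:E) _ _ _.
  rewrite !integral_indic// !setIT; apply.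
  - by move=> x; rewrite lee_fin.
  - by apply/measurable_EFinP; exact: measurable_indic.
  - have E u : \1_(f @^-1` A) u = \1_A (f u) :> R by [].
    move=> u v; rewrite !E.
    by case: (Hf u v) => -[-> ->] //; rewrite addeC.
have [M M0 HM] := total_cost_bounded cX cY cZ.
have cl' : coupling3 mu nu ga lam'.
  have [c1 [c2 c3]] := cl; split; [|split] => A mA.
  - rewrite -c1//; apply: mE => //; first exact: measurable_x.
    by move=> u v; case: bx @s {lt Hlam' marg}; [right|left].
  - rewrite -c2//; apply: mE => //; first exact: measurable_y.
    by move=> u v; case: b_y @s {lt Hlam' marg}; [right|left].
  - rewrite -c3//; apply: mE => //; first exact: measurable_z.
    by move=> u v; case: bz @s {lt Hlam' marg}; [right|left].
have L0 := Hlam' _ (opt _ cl').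
have {}L0 := L0 (le_lt_trans (andP (HM _ cl)).2 (ltry M)).
pose W := [set u : V3 * V3 | cost3 (swap3 bx b_y bz u : T3 R n) +
  cost3 (swap3 bx b_y bz (u.2, u.1) : T3 R n) <
  cost3 (u.1 : T3 R n) + cost3 (u.2 : T3 R n)].
pose g (u : V3 * V3) : R := cost3 (u.1 : T3 R n) + cost3 (u.2 : T3 R n) -
  (cost3 (swap3 bx b_y bz u : T3 R n) + cost3 (swap3 bx b_y bz (u.2, u.1) : T3 R n)).
have WE : W = g @^-1` [set y | 0 < y].
  by apply/seteqP; split => u; rewrite /W /g /= subr_gt0.
(* The costs of the two original points are written as exchanges with all flags equal, so that one
   continuity lemma covers the four terms. *)
have cg u : {for u, continuous g}.
  apply: cont_at_add; [apply: cont_at_add|apply: cont_at_opp; apply: cont_at_add].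
  - rewrite (_ : (fun _ => _) = fun u => cost3 (swap3 false false false u : T3 R n)).
      exact: cost_swap3_cont.
    by apply/funext => -[[[a b] c] d].
  - rewrite (_ : (fun _ => _) = fun u => cost3 (swap3 true true true u : T3 R n)).
      exact: cost_swap3_cont.
    by apply/funext => -[a [[b c] d]].
  - exact: cost_swap3_cont.
  - rewrite (_ : (fun _ => _) = fun u => cost3 (swap3 (~~ bx) (~~ b_y) (~~ bz) u : T3 R n)).
      exact: cost_swap3_cont.
    by apply/funext => v; rewrite swap3C.
have oW : open W by rewrite WE; apply: open_comp => [u _|]; [exact: cg|exact: open_gt].
have [[A B] [/= Ap Bq] AB] : nbhs (p, q) W by exact: open_nbhs_nbhs.
move: Ap Bq; rewrite !nbhsE => -[A' [oA A'p] A'A] [B' [oB B'q] B'B].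
have := mule_gt0 (Sp _ oA A'p) (Sq _ oB B'q).
rewrite -product_measure1E; [|exact: open_T3|exact: open_T3].
apply/negP; rewrite -leNgt -L0; apply: le_measure.
- by apply: mem_set; apply: measurableX; exact: open_T3.
- apply: mem_set.
  have mg : measurable_fun setT (g : T3 R n * T3 R n -> R).
    have ms := measurable_swap3.
    apply: measurable_funB; apply: measurable_funD.
    + exact: (measurableT_comp (@measurable_cost3 R n) measurable_fst).
    + exact: (measurableT_comp (@measurable_cost3 R n) measurable_snd).
    + exact: (measurableT_comp (@measurable_cost3 R n) (ms bx b_y bz)).
    + apply: (measurableT_comp (@measurable_cost3 R n)).
      apply: (measurableT_comp (ms bx b_y bz)).
      by apply: measurable_fun_pair; [exact: measurable_snd|exact: measurable_fst].
  rewrite [X in measurable X](_ : _ = g @^-1` `]0, +oo[%classic).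
    by rewrite -[X in measurable X]setTI; exact: mg.
  by rewrite -/W WE; apply/seteqP; split => u; rewrite /= in_itv /= andbT.
- by move=> [a b] [Aa Bb]; apply: AB; split; [exact: A'A|exact: B'B].
Qed.

End plan_support.

(** * The twist condition *)

Section euclid.
Variables (R : realType) (n : nat).
Local Notation V := 'rV[R]_n.
Implicit Types x y z : V.

Lemma dotmulC x y : dotmul x y = dotmul y x.
Proof. by apply: eq_bigr => j _; rewrite mulrC. Qed.

Lemma dotmulDl x y z : dotmul (x + y) z = dotmul x z + dotmul y z.
Proof. by rewrite /dotmul -big_split; apply: eq_bigr => j _; rewrite !mxE mulrDl. Qed.

Lemma dotmulZl (a : R) x y : dotmul (a *: x) y = a * dotmul x y.
Proof. by rewrite /dotmul mulr_sumr; apply: eq_bigr => j _; rewrite !mxE mulrA. Qed.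

Lemma dotmulNl x y : dotmul (- x) y = - dotmul x y.
Proof. by rewrite -scaleN1r dotmulZl mulN1r. Qed.

Lemma dotmulBl x y z : dotmul (x - y) z = dotmul x z - dotmul y z.
Proof. by rewrite dotmulDl dotmulNl. Qed.

Lemma dotmulZr (a : R) x y : dotmul x (a *: y) = a * dotmul x y.
Proof. by rewrite dotmulC dotmulZl dotmulC. Qed.

Lemma dotmulBr x y z : dotmul x (y - z) = dotmul x y - dotmul x z.
Proof. by rewrite dotmulC dotmulBl !(dotmulC x). Qed.

Lemma enorm_dot x : enorm x ^+ 2 = dotmul x x.
Proof. by rewrite enorm_sqr; apply: eq_bigr => j _; rewrite expr2. Qed.

Lemma dotmul_eq0 x : dotmul x x <= 0 -> x = 0.
Proof.
move=> H; have : dotmul x x == 0.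
  by rewrite eq_le H -enorm_dot sqr_ge0.
rewrite /dotmul psumr_eq0; last by move=> j _; rewrite -expr2 sqr_ge0.
move=> /allP H'; apply/rowP => j; rewrite mxE.
have := H' j (mem_index_enum j); rewrite /= mulf_eq0 orbb => /eqP ->.
by [].
Qed.

Lemma enorm_eq0 x : enorm x = 0 -> x = 0.
Proof. by move=> H; apply: dotmul_eq0; rewrite -enorm_dot H expr0n. Qed.

Lemma dotmul0l x : dotmul 0 x = 0.
Proof. by rewrite -(scale0r (0 : V)) dotmulZl mul0r. Qed.

Lemma cauchy_schwarz x y : dotmul x y <= enorm x * enorm y.
Proof.
have [x0|x0] := eqVneq (enorm x) 0.
  by rewrite x0 mul0r (enorm_eq0 x0) dotmul0l.
have [y0|y0] := eqVneq (enorm y) 0.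
  by rewrite y0 mulr0 (enorm_eq0 y0) dotmulC dotmul0l.
have := sqr_ge0 (enorm (enorm y *: x - enorm x *: y)).
rewrite enorm_dot dotmulBl !dotmulBr !dotmulZl !dotmulZr -!enorm_dot (dotmulC y x).
have a0 : 0 < enorm x by rewrite lt_def x0 enorm_ge0.
have b0 : 0 < enorm y by rewrite lt_def y0 enorm_ge0.
move: (enorm x) (enorm y) (dotmul x y) a0 b0 => a b t a0 b0 H.
have : 0 <= (2 * a * b) * (a * b - t) by lra.
rewrite pmulr_rge0 ?subr_ge0//; nra.
Qed.

(** The gradient of the norm at [x != 0]. At the origin it is 0, which is still a subgradient, so
    [enorm_subgrad] holds at every point. *)
Definition dir x := (enorm x)^-1 *: x.

Lemma enorm_subgrad x y : dotmul (dir y) (x - y) <= enorm x - enorm y.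
Proof.
rewrite /dir dotmulZl dotmulBr -enorm_dot.
have [y0|y0] := eqVneq (enorm y) 0.
  by rewrite y0 invr0 mul0r subr0 enorm_ge0.
have b0 : 0 < enorm y by rewrite lt_def y0 enorm_ge0.
rewrite mulrC ler_pdivrMr// mulrBl -expr2 lerD2r.
by rewrite dotmulC; exact: cauchy_schwarz.
Qed.

Lemma enorm_subsqr x z : enorm (x - z) ^+ 2 =
  enorm x ^+ 2 - 2 * dotmul x z + enorm z ^+ 2.
Proof.
by rewrite !enorm_dot dotmulBl !dotmulBr (dotmulC z x); ring.
Qed.

Lemma dir_dot x : enorm x != 0 -> dotmul (dir x) (dir x) = 1.
Proof.
move=> x0; rewrite /dir dotmulZl dotmulZr -enorm_dot expr2.
by rewrite [X in _ * X]mulrA mulVf// mul1r mulVf.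
Qed.

End euclid.

Section twist.
Variables (R : realType) (n : nat).
Local Notation V := 'rV[R]_n.

(* The twist condition on splitting sets: with e_i the unit vector from y_i to
   x, the gradients in x agree iff e0 - e1 = 2 (z0 - z1), and then
   (y0 - y1).(z0 - z1) >= 0 reads (r0 + r1) (1 - e0.e1) <= 0. *)
Lemma twist (x y0 y1 z0 z1 : V) : x != y0 -> x != y1 ->
  dir (x - y0) - 2 *: z0 = dir (x - y1) - 2 *: z1 ->
  0 <= dotmul (y0 - y1) (z0 - z1) -> z0 = z1.
Proof.
have ne y : x != y -> enorm (x - y) != 0.
  by move=> xy; apply/eqP => /enorm_eq0/eqP; rewrite subr_eq0 (negbTE xy).
move=> /ne n0 /ne n1 E H.
have r0 : 0 < enorm (x - y0) by rewrite lt_def n0 enorm_ge0.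
have r1 : 0 < enorm (x - y1) by rewrite lt_def n1 enorm_ge0.
have d0 := dir_dot n0; have d1 := dir_dot n1.
have y0E : y0 = x - enorm (x - y0) *: dir (x - y0).
  by rewrite /dir scalerA mulfV// scale1r opprB addrC subrK.
have y1E : y1 = x - enorm (x - y1) *: dir (x - y1).
  by rewrite /dir scalerA mulfV// scale1r opprB addrC subrK.
have zE : 2 *: (z0 - z1) = dir (x - y0) - dir (x - y1).
  by apply/rowP => j; have /rowP/(_ j) := E; rewrite !mxE; lra.
have yE : y0 - y1 = enorm (x - y1) *: dir (x - y1) - enorm (x - y0) *: dir (x - y0).
  by rewrite {1}y0E {1}y1E; apply/rowP => j; rewrite !mxE; ring.
have : 0 <= dotmul (y0 - y1) (2 *: (z0 - z1)) by rewrite dotmulZr mulr_ge0.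
rewrite zE yE; move: d0 d1 zE.
move: (dir (x - y0)) (dir (x - y1)) (enorm (x - y0)) (enorm (x - y1)) r0 r1.
move=> e f r s r0 s0 ee ff zE.
rewrite dotmulBl !dotmulZl !dotmulBr ee ff (dotmulC f e) => K.
have ef : 1 - dotmul e f <= 0.
  have : (r + s) * (1 - dotmul e f) <= 0 by lra.
  by rewrite pmulr_rle0// addr_gt0.
have : e - f = 0.
  apply: dotmul_eq0; rewrite dotmulBl !dotmulBr ee ff (dotmulC f e); lra.
rewrite -zE => /eqP; rewrite scaler_eq0 pnatr_eq0 /= subr_eq0 => /eqP.
by [].
Qed.

End twist.

(** * Splitting sets and their exceptional null sets *)

Section splitting.
Variables (R : realType) (n : nat).
Local Notation V := 'rV[R]_n.
Local Notation V3 := ((V * V) * V)%type.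
Variable Ga : set V3.
Hypothesis Ga_swap : forall bx b_y bz p q, Ga p -> Ga q ->
  cost3 (p : T3 R n) + cost3 (q : T3 R n) <=
  cost3 (swap3 bx b_y bz (p, q) : T3 R n) + cost3 (swap3 bx b_y bz (q, p) : T3 R n).

Lemma dir_cont (x y : V) : x != y -> {for x, continuous (fun t : V => dir (t - y))}.
Proof.
move=> xy; apply: cont_at_row => j.
have ct : {for x, continuous (fun t : V => t)} by exact: cvg_id.
have ce : {for x, continuous (fun t : V => (enorm (t - y))^-1)}.
  apply: cont_at_inv.
    by apply/eqP => /enorm_eq0/eqP; rewrite subr_eq0 (negbTE xy).
  by apply: enorm_cont => //; exact: cont_at_cst.
have cj : {for x, continuous (fun t : V => t ord0 j + - y ord0 j)}.
  by apply: cont_at_add; [exact: cont_at_coord|exact: cont_at_cst].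
rewrite (_ : (fun t : V => _) = fun t : V =>
  (enorm (t - y))^-1 * (t ord0 j + - y ord0 j)); first exact: cont_at_mul.
by apply/funext => t; rewrite !mxE.
Qed.

(** The cost depends on [x] through [g] and [enorm x ^+ 2], and the latter cancels in an exchange.
    What is left is convex in [x] with gradient [P], which is continuous there since [x != y]. *)
Lemma splitting_null_x : (forall p, Ga p -> p.1.1 != p.1.2) ->
  exists N : set (Rn R n), [/\ measurable N,
    forall mu : probability (Rn R n) R, leb_abs_cont mu -> mu N = 0%E &
    forall x y0 z0 y1 z1, Ga ((x, y0), z0) -> Ga ((x, y1), z1) -> ~ N x ->
      dir (x - y0) - 2 *: z0 = dir (x - y1) - 2 *: z1].
Proof.
move=> ne.
pose G (x : V) (w : V * V) := Ga ((x, w.1), w.2).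
pose g (x : V) (w : V * V) := enorm (x - w.1) - 2 * dotmul x w.2.
pose P (x : V) (w : V * V) := dir (x - w.1) - 2 *: w.2.
have [||x w Gx|N [mN muN HN]] := @monotone_null R n (V * V)%type G g P.
- move=> x x' [y z]; rewrite /P /g /= dotmulBl dotmulZl.
  have := enorm_subgrad (x - y) (x' - y).
  rewrite (_ : x - y - (x' - y) = x - x'); last first.
    by apply/rowP => j; rewrite !mxE; ring.
  have -> : dotmul z (x - x') = dotmul x z - dotmul x' z.
    by rewrite dotmulBr !(dotmulC z).
  lra.
- move=> x [y z] x' [y' z'] Gx Gx'; rewrite /g /=.
  have := Ga_swap true false false Gx Gx'.
  rewrite /cost3 /swap3 /pick2 /= !(enorm_subsqr x) !(enorm_subsqr x').
  lra.
- have c : {for x, continuous (fun x' : V => dir (x' - w.1))}.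
    by apply: dir_cont; exact: ne Gx.
  apply: cont_at_row => j.
  rewrite (_ : (fun t => _) = fun t : V => dir (t - w.1) ord0 j + - (2 *: w.2) ord0 j).
    by apply: cont_at_add; [exact: cont_at_coord|exact: cont_at_cst].
  by apply/funext => t; rewrite /P !mxE.
- exists N; split => // x y0 z0 y1 z1 G0 G1.
  exact: (HN x (y0, z0) (y1, z1)).
Qed.

(** The term [2 * enorm z ^+ 2] cancels in an exchange of [z], leaving a function linear in [z]
    whose gradient is the constant [- 2 *: (x + y)]. *)
Lemma splitting_null_z :
  exists N : set (Rn R n), [/\ measurable N,
    forall mu : probability (Rn R n) R, leb_abs_cont mu -> mu N = 0%E &
    forall x0 y0 x1 y1 z, Ga ((x0, y0), z) -> Ga ((x1, y1), z) -> ~ N z ->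
      x0 + y0 = x1 + y1].
Proof.
pose G (z : V) (w : V * V) := Ga (w, z).
pose g (z : V) (w : V * V) := - 2 * dotmul (w.1 + w.2) z.
pose P (z : V) (w : V * V) := - 2 *: (w.1 + w.2).
have [||z w Gz|N [mN muN HN]] := @monotone_null R n (V * V)%type G g P.
- by move=> z z' w; rewrite /P /g dotmulZl dotmulBr mulrBr.
- move=> z [x y] z' [x' y'] Gz Gz'; rewrite /g /= !dotmulDl.
  have := Ga_swap false false true Gz Gz'.
  rewrite /cost3 /swap3 /pick2 /= !enorm_subsqr.
  lra.
- exact: cont_at_cst.
- exists N; split => // x0 y0 x1 y1 z G0 G1 nN.
  have := HN z (x0, y0) (x1, y1) G0 G1 nN; rewrite /P /=.
  by move=> /(scalerI _); apply; rewrite oppr_eq0 pnatr_eq0.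
Qed.

(** Exchanging [y] between two points with the same [x] only permutes the terms [enorm (x - y)];
    what remains is the sign of [(y0 - y1) . (z0 - z1)] that [twist] asks for. Once [z0 = z1], the
    sum [x + y] is determined by [z0]. *)
Lemma splitting_graph (N1 N2 : set V) : (forall p, Ga p -> p.1.1 != p.1.2) ->
  (forall x y0 z0 y1 z1, Ga ((x, y0), z0) -> Ga ((x, y1), z1) -> ~ N1 x ->
      dir (x - y0) - 2 *: z0 = dir (x - y1) - 2 *: z1) ->
  (forall x0 y0 x1 y1 z, Ga ((x0, y0), z) -> Ga ((x1, y1), z) -> ~ N2 z ->
      x0 + y0 = x1 + y1) ->
  forall x y0 z0 y1 z1, Ga ((x, y0), z0) -> Ga ((x, y1), z1) -> ~ N1 x ->
    ~ N2 z0 -> y0 = y1 /\ z0 = z1.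
Proof.
move=> ne H1 H2 x y0 z0 y1 z1 G0 G1 n1 n2.
have zz : z0 = z1.
  apply: (twist (ne _ G0) (ne _ G1) (H1 _ _ _ _ _ G0 G1 n1)).
  have := Ga_swap false true false G0 G1.
  rewrite /cost3 /swap3 /pick2 /= !(enorm_subsqr y0) !(enorm_subsqr y1).
  rewrite dotmulBl !dotmulBr; lra.
split => //; rewrite -zz in G1.
exact: addrI (H2 _ _ _ _ _ G0 G1 n2).
Qed.

End splitting.

(** * Optimal plans are carried by graphs *)

Section graph.
Variables (R : realType) (n : nat) (mu nu ga : probability (Rn R n) R).
Local Notation V := 'rV[R]_n.
Local Notation V3 := ((V * V) * V)%type.
Hypotheses (cX : compact (msupport mu)) (cY : compact (msupport nu))
  (cZ : compact (msupport ga)) (XY : msupport mu `&` msupport nu = set0)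
  (acmu : leb_abs_cont mu) (acga : leb_abs_cont ga).

Lemma closed_supp3 : closed (supp3 mu nu ga).
Proof.
have cl (f : V3 -> V) (m : probability (Rn R n) R) : continuous f ->
    closed (f @^-1` msupport m).
  move=> cf; apply: closed_comp => [p _|]; first exact: cf.
  by have [] := msupport_full m.
exact: (closedI (closedI (cl _ mu (@cont_x R n)) (cl _ nu (@cont_y R n)))
  (cl _ ga (@cont_z R n))).
Qed.

(** The null sets are enclosed in open sets of measure below [k.+1%:R^-1], so that the rest of the
    support is compact. This sigma-compact form is what makes the resulting map Borel. *)
Lemma plan_graph (lam : probability (T3 R n) R) : optimal_plan mu nu ga lam ->
  exists K : nat -> set V3, [/\ forall k, compact (K k),
    forall k, K k `<=` supp3 mu nu ga,
    lam (\bigcup_k K k : set (T3 R n)) = 1%E &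
    forall p q, (\bigcup_k K k) p -> (\bigcup_k K k) q -> p.1.1 = q.1.1 -> p = q].
Proof.
move=> opt; have [cl _] := opt.
pose Ga : set V3 := plan_supp lam `&` supp3 mu nu ga.
have sw bx b_y bz p q : Ga p -> Ga q ->
    cost3 (p : T3 R n) + cost3 (q : T3 R n) <=
    cost3 (swap3 bx b_y bz (p, q) : T3 R n) + cost3 (swap3 bx b_y bz (q, p) : T3 R n).
  by move=> [Sp _] [Sq _]; exact: (optimal_swap cX cY cZ bx b_y bz opt Sp Sq).
have ne p : Ga p -> p.1.1 != p.1.2.
  move=> [_ [[px py] _]]; apply/eqP => E.
  have : (msupport mu `&` msupport nu) p.1.1 by split => //; rewrite E.
  by rewrite XY.
have [N1 [mN1 muN1 H1]] := splitting_null_x sw ne.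
have [N2 [mN2 gaN2 H2]] := splitting_null_z sw.
have e0 k : 0 < k.+1%:R^-1 :> R by rewrite invr_gt0.
have /choice [U1 HU1] : forall k : nat, exists U : set V,
    [/\ open U, N1 `<=` U & (mu (U : set (Rn R n)) < (k.+1%:R^-1)%:E)%E].
  by move=> k; apply: null_open_cover => //; exact: muN1.
have /choice [U2 HU2] : forall k : nat, exists U : set V,
    [/\ open U, N2 `<=` U & (ga (U : set (Rn R n)) < (k.+1%:R^-1)%:E)%E].
  by move=> k; apply: null_open_cover => //; exact: gaN2.
pose O k : set V3 := (fun p : V3 => p.1.1) @^-1` (U1 k) `|` (fun p : V3 => p.2) @^-1` (U2 k).
have oO k : open (O k).
  have [p1 _ _] := HU1 k; have [p2 _ _] := HU2 k.
  apply: openU; apply: open_comp => // p _; [exact: cont_x|exact: cont_z].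
pose K k : set V3 := Ga `&` ~` O k.
have [clS lS] := plan_supp_full lam.
have cK k : compact (K k).
  apply: (subclosed_compact _ (compact_supp3 cX cY cZ)); last by move=> p [[]].
  apply: closedI; last exact: open_closedC.
  by apply: closedI => //; exact: closed_supp3.
exists K; split => //.
- by move=> k p [[]].
- have mK k : measurable (K k : set (T3 R n)).
    apply: measurableI; last by apply: measurableC; exact: open_T3.
    by apply: measurableI; [exact: closed_T3|exact: measurable_supp3].
  apply: prob_setC0; first exact: bigcupT_measurable.
  apply/eqP; rewrite eq_le measure_ge0 andbT.
  apply/lee_addgt0Pr => e e00; rewrite add0e.
  have [k ke] : exists k : nat, k.+1%:R^-1 < e / 2.
    have e20 : 0 < e / 2 by rewrite divr_gt0.
    have [k _ Hk] := near_infty_natSinv_lt (PosNum e20).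
    by exists k; exact: Hk (leqnn k).
  have [p1 _ l1] := HU1 k; have [p2 _ l2] := HU2 k.
  have mOk : measurable (O k : set (T3 R n)) by exact: open_T3.
  have mSp : measurable (plan_supp lam : set (T3 R n)) by exact: closed_T3.
  have mS3 := @measurable_supp3 R n mu nu ga.
  have l0 : (lam (O k : set (T3 R n)) <= e%:E)%E.
    have mx := measurable_cyl (@measurable_x R n) (open_Rn p1).
    have mz := measurable_cyl (@measurable_z R n) (open_Rn p2).
    apply: le_trans (measureU2 lam mx mz) _.
    have [c1 [_ c3]] := cl.
    rewrite [X in (X + _)%E](c1 _ (open_Rn p1)) [X in (_ + X)%E](c3 _ (open_Rn p2)).
    apply: le_trans (leeD (ltW l1) (ltW l2)) _.
    rewrite -EFinD lee_fin; move: (k.+1%:R^-1) ke => u ke; lra.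
  apply: le_trans l0.
  have m1 : measurable (~` plan_supp lam : set (T3 R n)) by exact: measurableC.
  have m2 : measurable (~` supp3 mu nu ga : set (T3 R n)) by exact: measurableC.
  have E0 : lam ((~` plan_supp lam `|` ~` supp3 mu nu ga) : set (T3 R n)) = 0%E.
    apply/eqP; rewrite eq_le measure_ge0 andbT.
    apply: le_trans (measureU2 lam m1 m2) _.
    rewrite [X in (X + _)%E](prob_setC1 mSp lS).
    by rewrite [X in (_ + X)%E](prob_setC1 mS3 (coupling_supp3 cl)) adde0.
  have m3 := measurableU _ _ m1 m2.
  apply: (@le_trans _ _ (lam ((~` plan_supp lam `|` ~` supp3 mu nu ga)
      `|` O k : set (T3 R n)))).
    apply: le_measure.
    - by apply: mem_set; apply: measurableC; exact: bigcupT_measurable.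
    - by apply: mem_set; exact: measurableU.
    move=> p nKp; have [Op|nOp] := pselect (O k p); [by right|left].
    apply: contrapT => /not_orP[/contrapT Sp /contrapT S3].
    by apply: nKp; exists k.
  apply: le_trans (measureU2 lam m3 mOk) _.
  by rewrite [X in (X + _)%E]E0 add0e.
- have gr := splitting_graph sw ne H1 H2.
  move=> [[x y0] z0] [[x' y1] z1] [k _ [G0 n0]] [k' _ [G1 n1]] /= E.
  rewrite -E in G1 n1 *.
  have nx : ~ N1 x.
    by move=> Nx; apply: n0; left => /=; have [_ S _] := HU1 k; exact: S.
  have nz : ~ N2 z0.
    by move=> Nz; apply: n0; right => /=; have [_ S _] := HU2 k; exact: S.
  by have [-> ->] := gr _ _ _ _ _ G0 G1 nx nz.
Qed.

End graph.

(** * Plans carried by a graph *)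

Section graph_map.
Variables (R : realType) (n : nat).
Local Notation V := 'rV[R]_n.
Local Notation V3 := ((V * V) * V)%type.

(** Up to the points sent to the default [t0], the preimage of a closed set is a countable union of
    projections of compact sets, hence Borel. *)
Lemma measurable_graph_fun (K : nat -> set V3) (f : V3 -> V) (h : V -> V) (t0 : V) :
  (forall k, compact (K k)) -> continuous f ->
  (forall p, (\bigcup_k K k) p -> h p.1.1 = f p) ->
  (forall x, ~ (exists2 p, (\bigcup_k K k) p & p.1.1 = x) -> h x = t0) ->
  measurable_fun setT (h : Rn R n -> Rn R n).
Proof.
move=> cK cf hS h0.
have mimg (F : set V) k : closed F ->
    measurable ((fun p : V3 => p.1.1) @` (K k `&` f @^-1` F) : set (Rn R n)).
  move=> cF; apply: closed_Rn; apply: compact_closed.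
    exact: norm_hausdorff.
  apply: continuous_compact.
    by apply: continuous_subspaceT; exact: cont_x.
  apply: compact_closedI => //; apply: closed_comp => // p _; exact: cf.
have mcl (F : set V) : closed F -> measurable (h @^-1` F : set (Rn R n)).
  move=> cF.
  pose A (F : set V) := \bigcup_k ((fun p : V3 => p.1.1) @` (K k `&` f @^-1` F)).
  have mA F' : closed F' -> measurable (A F' : set (Rn R n)).
    by move=> cF'; apply: bigcupT_measurable => k; exact: mimg.
  rewrite (_ : h @^-1` F = A F `|` (~` A setT `&` [set x | F t0])).
    apply: measurableU; first exact: mA.
    apply: measurableI; first by apply: measurableC; apply: mA; exact: closedT.
    have [Ft|nFt] := pselect (F t0).
      by rewrite (_ : [set _ | _] = setT)//; apply/seteqP; split.
    by rewrite (_ : [set _ | _] = set0)//; apply/seteqP; split.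
  apply/seteqP; split => x /=.
    move=> Fx; have [[p [k _ Kp] px]|nx] := pselect (exists2 p, (\bigcup_k K k) p & p.1.1 = x).
      left; exists k => //; exists p => //; split => //=.
      by rewrite -(hS p) ?px//; exists k.
    right; split; last by rewrite -(h0 _ nx).
    by move=> [k _ [p [Kp _] px]]; apply: nx; exists p => //; exists k.
  move=> [[k _ [p [Kp Fp] <-]]|[nA Ft0]]; first by rewrite hS//; exists k.
  rewrite h0// => -[p [k _ Kp] px]; apply: nA; exists k => //.
  by exists p.
have E : @measurable _ (Rn R n) = <<s (@open V) >> by [].
apply: (measurability _ E).
move=> _ [U oU <-]; rewrite setTI -[U]setCK -preimage_setC.
by apply: measurableC; apply: mcl; exact: open_closedC.
Qed.

(** The default [(y0, z0)] off the projection of the graph makes [T] total and prescribes its values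
    there. *)
Lemma exists_graph_map (K : nat -> set V3) (y0 z0 : V) :
  (forall k, compact (K k)) ->
  (forall p q, (\bigcup_k K k) p -> (\bigcup_k K k) q -> p.1.1 = q.1.1 -> p = q) ->
  exists T : Rn R n -> Rn R n * Rn R n,
    [/\ measurable_fun setT T,
      forall p, (\bigcup_k K k) p -> T p.1.1 = (p.1.2, p.2) &
      forall x, (exists2 p, (\bigcup_k K k) p & p.1.1 = x) \/ T x = (y0, z0)].
Proof.
move=> cK inj.
have /choice [T HT] : forall x : V, exists w : V * V,
    (exists p, [/\ (\bigcup_k K k) p, p.1.1 = x & w = (p.1.2, p.2)]) \/
    (~ (exists2 p, (\bigcup_k K k) p & p.1.1 = x) /\ w = (y0, z0)).
  move=> x; have [[p Sp px]|nx] := pselect (exists2 p, (\bigcup_k K k) p & p.1.1 = x).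
    by exists (p.1.2, p.2); left; exists p.
  by exists (y0, z0); right.
have TS p : (\bigcup_k K k) p -> T p.1.1 = (p.1.2, p.2).
  move=> Sp; case: (HT p.1.1) => [[q [Sq qp ->]]|[np _]].
    by rewrite (inj q p).
  by exfalso; apply: np; exists p.
have T0 x : ~ (exists2 p, (\bigcup_k K k) p & p.1.1 = x) -> T x = (y0, z0).
  by move=> nx; case: (HT x) => [[q [Sq qx _]]|[]//]; exfalso; apply: nx; exists q.
exists T; split => //.
- apply/measurable_fun_pairP; split.
  + apply: (@measurable_graph_fun K (fun p => p.1.2) (fun x => (T x).1) y0 cK).
    * exact: cont_y.
    * by move=> p Sp; rewrite TS.
    * by move=> x nx; rewrite T0.
  + apply: (@measurable_graph_fun K (fun p => p.2) (fun x => (T x).2) z0 cK).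
    * exact: cont_z.
    * by move=> p Sp; rewrite TS.
    * by move=> x nx; rewrite T0.
- move=> x; have [Sx|nx] := pselect (exists2 p, (\bigcup_k K k) p & p.1.1 = x).
    by left.
  by right; exact: T0.
Qed.

Lemma measurable_graph_set (X : set (Rn R n)) (T : Rn R n -> Rn R n * Rn R n)
    (A : set (T3 R n)) : measurable X -> measurable_fun X T -> measurable A ->
  measurable (X `&` (fun x => ((x, (T x).1), (T x).2) : T3 R n) @^-1` A).
Proof.
(* As [T] is measurable on [X] only, it is replaced by its restriction, extended by a default
   value. *)
move=> mX /(measurable_restrictT _ mX) mT mA.
have mg : measurable_fun setT (fun x => ((x, ((T \_ X) x).1), ((T \_ X) x).2) : T3 R n).
  apply: (measurable_fun_pair (T1 := (Rn R n * Rn R n)%type) (T2 := Rn R n)).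
    apply: (measurable_fun_pair (T1 := Rn R n) (T2 := Rn R n)) => //.
    exact: (measurableT_comp measurable_fst mT).
  exact: (measurableT_comp measurable_snd mT).
have := measurableI _ _ mX (mg measurableT A mA); rewrite setTI.
congr measurable; apply/seteqP; split => x [Xx]; rewrite /= patchE mem_set//.
Qed.

(** On [S], which has full mass, a point lies in [A] exactly when its first coordinate lies in the
    set whose [mu] measure is taken; so the mass of [A] is read off the first marginal. *)
Lemma graph_induced (mu nu ga : probability (Rn R n) R) (lam : probability (T3 R n) R)
    (S : set (T3 R n)) (T : Rn R n -> Rn R n * Rn R n) :
  coupling3 mu nu ga lam -> measurable S -> lam S = 1%E ->
  (forall p, S p -> msupport mu p.1.1) ->
  measurable_fun (msupport mu : set (Rn R n)) T ->
  (forall p, S p -> T p.1.1 = (p.1.2, p.2)) ->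
  induced_by_map mu (msupport mu) T lam.
Proof.
move=> [cx _] mS lS SX mT TS A mA.
have mX : measurable (msupport mu : set (Rn R n)).
  by apply: closed_Rn; have [] := msupport_full mu.
have mG := measurable_graph_set mX mT mA.
rewrite -(cx _ mG).
have lI (B : set (T3 R n)) : measurable B -> lam B = lam (B `&` S).
  move=> mB; rewrite -[in LHS](setUIDK B S) measureU//.
  - rewrite [X in (_ + X)%E](_ : _ = 0%E) ?adde0//.
    apply/eqP; rewrite eq_le measure_ge0 andbT -(prob_setC1 mS lS).
    apply: le_measure.
    + by apply: mem_set; exact: measurableD.
    + by apply: mem_set; exact: measurableC.
    + by move=> x [].
  - exact: measurableI.
  - exact: measurableD.
  - by rewrite setDE setIACA setICr setI0.
have mE : measurable ((fun p : T3 R n => p.1.1) @^-1`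
    (msupport mu `&` (fun x => ((x, (T x).1), (T x).2) : T3 R n) @^-1` A)).
  exact: (measurable_cyl (@measurable_x R n) mG).
rewrite (lI A mA) [RHS](lI _ mE); congr (lam _).
apply/seteqP; split => -[[x y] z] [H Sp]; split => //.
  by split; [exact: (SX _ Sp)|rewrite /= (TS _ Sp)].
by move: H => [_] /=; rewrite (TS _ Sp).
Qed.

End graph_map.

(** * Uniqueness of the plan and of the map *)

(** Cost and marginals are affine in the plan. A set of mass one for the average has mass one for
    both plans, since neither mass exceeds one. *)
Lemma total_cost_mix (R : realType) (n : nat) (mu nu ga : probability (Rn R n) R)
    (l1 l2 : probability (T3 R n) R) :
  optimal_plan mu nu ga l1 -> optimal_plan mu nu ga l2 ->
  exists m : probability (T3 R n) R, optimal_plan mu nu ga m /\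
    forall A, measurable A -> m A = 1%E -> l1 A = 1%E /\ l2 A = 1%E.
Proof.
move=> [c1 o1] [c2 o2].
have [m [mE intm]] := exists_mix l1 l2; exists m; split; [split|].
- have [x1 [y1 z1]] := c1; have [x2 [y2 z2]] := c2.
  by split; [|split] => A mA; rewrite mE ?x1 ?x2 ?y1 ?y2 ?z1 ?z2// mule_half_double.
- move=> l cl; rewrite [leLHS]intm.
  + have -> : (\int[l1]_p (cost3 p)%:E = \int[l2]_p (cost3 p)%:E)%E.
      by apply/eqP; rewrite eq_le [X in X && _]o1// [X in _ && X]o2.
    rewrite mule_half_double; first exact: o2.
    by apply: integral_ge0 => p _; rewrite lee_fin cost3_ge0.
  + by move=> p; rewrite lee_fin cost3_ge0.
  + by apply/measurable_EFinP; exact: measurable_cost3.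
- move=> A mA; rewrite mE.
  have f1 : l1 A \is a fin_num by exact: fin_num_measure.
  have f2 : l2 A \is a fin_num by exact: fin_num_measure.
  have := probability_le1 l1 mA; have := probability_le1 l2 mA.
  rewrite -(fineK f1) -(fineK f2) !lee_fin -EFinD -EFinM => h2 h1 [h].
  by split; congr EFin; lra.
Qed.

Theorem mainTheorem10 (R : realType) (n : nat)
    (mu nu ga : probability (Rn R n) R) (X Y Z : set 'rV[R]_n) :
  X = msupport mu -> Y = msupport nu -> Z = msupport ga ->
  compact X -> compact Y -> compact Z ->
  X `&` Y = set0 ->
  leb_abs_cont mu -> leb_abs_cont ga ->
  exists lam : probability (T3 R n) R,
    optimal_plan mu nu ga lam /\
    (forall lam' : probability (T3 R n) R, optimal_plan mu nu ga lam' ->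
       forall A : set (T3 R n), measurable A -> lam' A = lam A) /\
    exists T : Rn R n -> Rn R n * Rn R n,
      measurable_fun (X : set (Rn R n)) T /\
      (forall x, X x -> Y (T x).1 /\ Z (T x).2) /\
      induced_by_map mu X T lam /\
      (forall T' : Rn R n -> Rn R n * Rn R n,
         measurable_fun (X : set (Rn R n)) T' ->
         (forall x, X x -> Y (T' x).1 /\ Z (T' x).2) ->
         induced_by_map mu X T' lam ->
         {ae mu, forall x, X x -> T' x = T x}).
Proof.
move=> -> -> -> cX cY cZ XY acmu acga.
have ne (m : probability (Rn R n) R) : exists y, msupport m y.
  apply/set0P/eqP => E; have [_] := msupport_full m; rewrite E.
  by rewrite [LHS]measure0 => /esym/eqP; rewrite onee_eq0.
(* Default values taken in the supports, so that the map lands in [Y] and [Z] also at points over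
   which the graph is empty. *)
have [y0 Yy0] := ne nu; have [z0 Zz0] := ne ga.
have mX : measurable (msupport mu : set (Rn R n)).
  by apply: closed_Rn; have [] := msupport_full mu.
(* The map is read off the graph carrying a plan; applied to the average of two
   optimal plans, the same graph carries both. *)
have induce (m : probability (T3 R n) R) : optimal_plan mu nu ga m ->
    exists S : set (T3 R n), exists T : Rn R n -> Rn R n * Rn R n,
    [/\ measurable S, m S = 1%E,
      (forall p, S p -> msupport mu p.1.1 /\ T p.1.1 = (p.1.2, p.2)),
      measurable_fun (msupport mu : set (Rn R n)) T &
      forall x, msupport mu x -> msupport nu (T x).1 /\ msupport ga (T x).2].
  move=> om; have [K [cK KS mK inj]] := plan_graph cX cY cZ XY acmu acga om.
  have [T [mT TS T0]] := exists_graph_map y0 z0 cK inj.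
  exists (\bigcup_k K k), T; split => //.
  - apply: bigcupT_measurable => k; apply: closed_T3.
    apply: compact_closed; last exact: cK.
    exact: norm_hausdorff.
  - by move=> p Sp; split; [by have [k _ /KS [[]]] := Sp|exact: TS].
  - exact: measurable_funTS.
  - move=> x _; case: (T0 x) => [[p Sp <-]|->//].
    by rewrite (TS p Sp) /=; have [k _ /KS [[_ ?] ?]] := Sp.
have [lam olam] := exists_optimal cX cY cZ; have [cl _] := olam.
have [S [T [mS lS ST mT TYZ]]] := induce _ olam.
exists lam; split => //; split.
  move=> lam' olam' A mA.
  have [m [om mix]] := total_cost_mix olam olam'; have [cl' _] := olam'.
  (* The map obtained for the average [m] induces both [lam] and [lam'], which are therefore the
     same image of [mu]. *)
  have [S' [T' [mS' mS1 ST' mT' _]]] := induce _ om.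
  have [l1 l2] := mix _ mS' mS1.
  have S1 p : S' p -> msupport mu p.1.1 by move=> /ST' [].
  have S2 p : S' p -> T' p.1.1 = (p.1.2, p.2) by move=> /ST' [].
  rewrite (graph_induced cl mS' l1 S1 mT' S2 mA).
  by rewrite (graph_induced cl' mS' l2 S1 mT' S2 mA).
have S1 p : S p -> msupport mu p.1.1 by move=> /ST [].
have S2 p : S p -> T p.1.1 = (p.1.2, p.2) by move=> /ST [].
exists T; split => //; split => //; split.
  exact: (graph_induced cl mS lS S1 mT S2).
move=> T' mT' _ indT'.
(* The points of [X] over which the graph of [T'] meets [S]. As [T'] induces [lam] and [lam S] is 1,
   they have full [mu] measure, and there [T'] equals [T]. *)
pose G := msupport mu `&` (fun x => ((x, (T' x).1), (T' x).2) : T3 R n) @^-1` S.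
have mG : measurable (G : set (Rn R n)) by exact: measurable_graph_set.
exists (~` G); split.
- exact: measurableC.
- by apply: prob_setC1 => //; rewrite -(indT' S mS).
- move=> x /= H [Xx Sx]; apply: H => _.
  by have /= -> := S2 _ Sx; case: (T' x).
Qed.
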